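(* Let $n=3\cdot 2^k$ or $n=2^k$ for some integer $k\ge 1$, let $1<p\le q<\infty$, and let $t\ge 0$. Then $$\|P_t f\|_q\le \|f\|_p\ \text{ for all } f\in L_\infty(\mathbb{Z}_n,\mu_n)\qquad\Longleftrightarrow\qquad t\ge \frac12\log\left(\frac{q-1}{p-1}\right),$$ where $(P_t)_{t\ge 0}$ is the Poisson-like semigroup on $\mathbb{Z}_n$.
   Context: $\mathbb{Z}_n=\{0,1,\dots,n-1\}$ is the cyclic group of order $n$, equipped with the normalized counting measure $\mu_n$ (each point has mass $1/n$). $L_\infty(\mathbb{Z}_n,\mu_n)$ is the space of all complex-valued functions on $\mathbb{Z}_n$, and $\|f\|_p=\big(\frac1n\sum_{x\in\mathbb{Z}_n}|f(x)|^p\big)^{1/p}$. For $0\le k\le n-1$, $\chi_k(x)=e^{2\pi i kx/n}$; every function on $\mathbb{Z}_n$ is uniquely of the form $\sum_{k=0}^{n-1}a_k\chi_k$ with $a_k\in\mathbb{C}$. The word-length function is $\psi_n(k)=\min(k,n-k)$ for $0\le k\le n-1$. The Poisson-like semigroup $(P_t)_{t\ge0}$ is given by $$P_t\Big(\sum_{k=0}^{n-1}a_k\chi_k\Big)=\sum_{k=0}^{n-1}e^{-t\psi_n(k)}a_k\chi_k .$$ *)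

(* Defs.v *)
From mathcomp Require Import all_boot all_order all_algebra.
From mathcomp Require Import complex.
From mathcomp Require Import reals sequences exp trigo.
From mathcomp Require Import ring.
Set Implicit Arguments.
Unset Strict Implicit.
Unset Printing Implicit Defensive.

Import Order.TTheory GRing.Theory Num.Theory.
Local Open Scope ring_scope.
Local Open Scope complex_scope.

(* Complex functions on the cyclic group {0, ..., n-1} are represented as
   'I_n -> R[i]; 'Z_n is avoided since it is not of order n when n < 2. *)

(* e^(i a), for real a *)
Definition expi (R : realType) (a : R) : R[i] := cos a +i* sin a.
Arguments expi : simpl never.

Definition chi (R : realType) (n : nat) (k x : 'I_n) : R[i] :=
  expi (2 * pi * (k : nat)%:R * (x : nat)%:R / n%:R).
Arguments chi : simpl never.

Definition psi (n : nat) (k : 'I_n) : nat := minn k (n - k).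

(* L_p norm for the normalized counting measure. [Normc.normc] is the R-valued
   modulus ([`|z|] has values in R[i]), and 0 `^ p = 0 for p != 0. *)
Definition pnorm (R : realType) (n : nat) (p : R) (f : 'I_n -> R[i]) : R :=
  (n%:R^-1 * \sum_(x < n) Normc.normc (f x) `^ p) `^ p^-1.

(* The coefficient of chi_k in the expansion of f on the characters: see
   [fcoef_trig] and [fcoef_inv] for its uniqueness and existence. *)
Definition fcoef (R : realType) (n : nat) (f : 'I_n -> R[i]) (k : 'I_n) : R[i] :=
  n%:R^-1 * \sum_(x < n) f x * (chi R k x)^*%C.

(* The Poisson-like semigroup P_t; [poisson_trig] gives its value on an
   arbitrary combination of the characters. *)
Definition poisson (R : realType) (n : nat) (t : R) (f : 'I_n -> R[i]) (x : 'I_n) : R[i] :=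
  \sum_(k < n) (expR (- t * (psi k)%:R))%:C * fcoef f k * chi R k x.

Lemma expiD (R : realType) (a b : R) : expi (a + b) = expi a * expi b.
Proof. by rewrite /expi cosD sinD; simpc; congr (_ +i* _); rewrite addrC. Qed.

Lemma expi0 (R : realType) : expi (0 : R) = 1.
Proof. by rewrite /expi cos0 sin0. Qed.

Lemma expiN (R : realType) (a : R) : expi (- a) = (expi a)^*%C.
Proof. by rewrite /expi cosN sinN. Qed.

Lemma expiMn (R : realType) (a : R) (m : nat) : expi (a * m%:R) = expi a ^+ m.
Proof.
elim: m => [|m IH]; first by rewrite mulr0 expi0.
by rewrite -natr1 mulrDr mulr1 expiD IH exprSr.
Qed.

Lemma expi_2pi (R : realType) (m : nat) : expi (2 * pi * m%:R : R) = 1.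
Proof.
by rewrite expiMn /expi mulr_natl cos2pi sin2pi complexr0 expr1n.
Qed.

Lemma expi_neq1 (R : realType) (a : R) : 0 < a -> a < 2 * pi -> expi a != 1.
Proof.
move=> a0 a2pi; apply/eqP => -[cosa _].
have s0 : 0 < sin (a / 2).
  by apply: sin_gt0_pi; rewrite ?divr_gt0// ltr_pdivrMr// mulrC.
have e : cos a = 1 - 2 * sin (a / 2) ^+ 2.
  by rewrite {1}[a](splitr a) cosD -!expr2 cos2sin2; ring.
by move: cosa; rewrite e => /eqP; rewrite subr_eq addrC -subr_eq subrr eq_sym
  mulf_eq0 pnatr_eq0 /= sqrf_eq0 (gt_eqF s0).
Qed.

Lemma chi_ortho_lt (R : realType) (n : nat) (j k : 'I_n) : (k < j)%N ->
  \sum_(x < n) chi R j x * (chi R k x)^*%C = 0.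
Proof.
move=> kj; have n0 : (0 < n)%N by apply: leq_ltn_trans (ltn_ord j).
have nR : n%:R != 0 :> R by rewrite pnatr_eq0 -lt0n.
set a : R := 2 * pi * (j - k)%:R / n%:R.
have -> : \sum_(x < n) chi R j x * (chi R k x)^*%C = \sum_(x < n) expi a ^+ x.
  apply: eq_bigr => x _; rewrite !/chi -expiN -expiD -expiMn /a natrB 1?ltnW//.
  by congr expi; field.
have a1 : expi a != 1.
  apply: expi_neq1.
    by rewrite divr_gt0 ?ltr0n// !mulr_gt0 ?pi_gt0 ?ltr0n// subn_gt0.
  rewrite ltr_pdivrMr ?ltr0n// ltr_pM2l ?mulr_gt0 ?pi_gt0// ltr_nat.
  exact: leq_ltn_trans (leq_subr _ _) (ltn_ord j).
apply: (mulfI (_ : expi a - 1 != 0)); first by rewrite subr_eq0.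
by rewrite -subrX1 -expiMn /a divfK// expi_2pi subrr mulr0.
Qed.

Lemma chi_ortho (R : realType) (n : nat) (j k : 'I_n) :
  \sum_(x < n) chi R j x * (chi R k x)^*%C = (j == k)%:R * n%:R.
Proof.
have [->|jk] := eqVneq j k.
  rewrite mul1r (eq_bigr (fun=> 1)) ?sumr_const ?card_ord// => x _.
  by rewrite !/chi -expiN -expiD subrr expi0.
rewrite mul0r; case: (ltngtP j k) => [jk'|kj|/val_inj e]; last 2 first.
- exact: chi_ortho_lt.
- by rewrite e eqxx in jk.
have cD (u v : R[i]) : (u + v)^*%C = u^*%C + v^*%C by exact: rmorphD.
have cM (u v : R[i]) : (u * v)^*%C = u^*%C * v^*%C by exact: rmorphM.
apply: (can_inj (@conjcK R)); rewrite [RHS]conjc0 -[RHS](chi_ortho_lt R jk').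
rewrite (big_morph (@conjc R) cD (conjc0 R)); apply: eq_bigr => x _.
by rewrite cM conjcK mulrC.
Qed.

Lemma fcoef_trig (R : realType) (n : nat) (a : 'I_n -> R[i]) (k : 'I_n) :
  fcoef (fun x => \sum_(j < n) a j * chi R j x) k = a k.
Proof.
have nR : n%:R != 0 :> R[i].
  by rewrite pnatr_eq0 -lt0n (leq_ltn_trans _ (ltn_ord k)).
rewrite /fcoef.
under eq_bigr do rewrite mulr_suml.
rewrite exchange_big /=.
under eq_bigr => j _.
  under eq_bigr do rewrite -mulrA.
  rewrite -mulr_sumr chi_ortho; over.
rewrite (bigD1 k)//= big1 => [|j /negPf->]; last by rewrite mul0r mulr0.
by rewrite eqxx mul1r addr0 mulrCA mulVf ?mulr1.
Qed.

Lemma chiC (R : realType) (n : nat) (k x : 'I_n) : chi R k x = chi R x k.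
Proof. by rewrite /chi; congr expi; rewrite -!mulrA; do 2 congr *%R; rewrite mulrCA. Qed.

Lemma fcoef_inv (R : realType) (n : nat) (f : 'I_n -> R[i]) (x : 'I_n) :
  \sum_(k < n) fcoef f k * chi R k x = f x.
Proof.
have nR : n%:R != 0 :> R[i].
  by rewrite pnatr_eq0 -lt0n (leq_ltn_trans _ (ltn_ord x)).
rewrite /fcoef.
under eq_bigr do rewrite -mulrA mulr_suml.
rewrite -mulr_sumr exchange_big /=.
under eq_bigr => y _.
  rewrite (eq_bigr (fun k => f y * (chi R x k * (chi R y k)^*%C))); last first.
    by move=> k _; rewrite -mulrA (chiC _ y) (chiC _ x) [X in _ * X]mulrC.
  rewrite -mulr_sumr chi_ortho; over.
rewrite (bigD1 x)//= big1 => [|y]; last by rewrite eq_sym => /negPf->; rewrite mul0r mulr0.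
by rewrite eqxx mul1r addr0 mulrCA mulVf ?mulr1.
Qed.

Lemma poisson_trig (R : realType) (n : nat) (t : R) (a : 'I_n -> R[i]) (x : 'I_n) :
  poisson t (fun y => \sum_(k < n) a k * chi R k y) x =
  \sum_(k < n) (expR (- t * (psi k)%:R))%:C * a k * chi R k x.
Proof. by apply: eq_bigr => k _; rewrite fcoef_trig. Qed.

(* Main.v *)
Require Import Defs.
From mathcomp Require Import all_boot all_order all_algebra.
From mathcomp Require Import complex.
From mathcomp Require Import boolp classical_sets interval_inference topology normedtype derive realfun.
From mathcomp Require Import reals sequences exp trigo.
From mathcomp Require Import ring lra zify.
Set Implicit Arguments.
Unset Strict Implicit.
Unset Printing Implicit Defensive.

Import Order.TTheory GRing.Theory Num.Theory.
Import numFieldNormedType.Exports.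
Local Open Scope ring_scope.

(** The condition on [t] is necessary because of the functions 1 + e cos(2 pi x / n):
    both norms equal 1 at first order, and their second order terms compare as
    (q - 1) e^(-2t) with p - 1 ([hypercontractive_necessary]).

    Sufficiency rests on the logarithmic Sobolev inequality
        Ent(f^2) <= 2 sum_k psi(k) |f^(k)|^2      (f >= 0, [log_sob_all])
    through the argument of Gross. For even n the kernel of P_t is positive (its closed form is
    a Poisson kernel, [kernel_gt0]), hence the energy is a sum over jumps with nonnegative rates
    ([dirichlet_jump]), and the inequality of Stroock and Varopoulos applies to each jump.
    It follows that ln |P_s f|_{q(s)} does not increase along q(s) = 1 + (p - 1) e^(2ls) for
    0 <= l <= 1 ([lognorm_nonincreasing]); l is chosen so that q(t) = q. The positivity
    of the kernel also reduces complex functions to positive ones.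

    The logarithmic Sobolev inequality is proved by doubling n. A function f on Z_2n, with
    coefficients F_k, restricts to functions a and b on the even and the odd points, and
    a^(j) = F_j + F_(j+n),  |b^(j)| = |F_j - F_(j+n)|. The chain rule for the entropy leaves the
    entropy of the pair (|a|_2^2, |b|_2^2), which is at most (|a|_2 - |b|_2)^2 / 2. On the other
    side the energy of f exceeds the mean energy of a and b by sum_j |n - 2j| |g_j|^2, where
    g_j is the one of F_j, F_(j+n) with the larger word length; as |a^(j)| and |b^(j)| differ
    by at most 2 |g_j|, this pays for the difference of the norms, except at j = n/2, where
    the weight |n - 2j| vanishes. There one uses that |a^(n/2)| <= a^(0), so that this coefficient
    moves the norm of a by less than its own size, and one lets the induction carry a
    stronger inequality in which the energy of the frequency n/2 is diminished by 1/5
    ([log_sob_double]). The frequency n of f has the largest weight, so the stronger inequality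
    is recovered for 2n.

    The induction starts at 4 and 6 ([log_sob_Z4], [log_sob_Z6]). The inequality fails on Z_3,
    so 6 cannot be reached by doubling. Both cases follow from an expansion around the mean: a
    quartic upper bound of y^2 ln y^2 around 1 bounds the entropy by the first four moments of
    f - 1 ([entropy_le_moments]), and what remains is a polynomial inequality in the coefficients
    of f. *)

(** * Derivatives of real functions *)

Section Calculus.
Context {R : realType}.
Implicit Types (f g : R -> R) (x y z a b : R).

Lemma eqle x y : x = y -> x <= y.
Proof. by move=> ->. Qed.

(** A separate head for [is_derive x 1], so that instance resolution does not unfold
    compound functions while [der] below decomposes them. *)
Definition hasder f x a := is_derive x 1 f a.

Lemma der_cst a x : hasder (fun=> a) x 0.
Proof. exact: is_derive_cst. Qed.

Lemma der_id x : hasder (fun y => y) x 1.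
Proof. exact: is_derive_id. Qed.

Lemma der_add f g x a b : hasder f x a -> hasder g x b ->
  hasder (fun y => f y + g y) x (a + b).
Proof. by rewrite /hasder => *; exact: is_deriveD. Qed.

Lemma der_opp f x a : hasder f x a -> hasder (fun y => - f y) x (- a).
Proof. by rewrite /hasder => *; exact: is_deriveN. Qed.

Lemma der_mul f g x a b : hasder f x a -> hasder g x b ->
  hasder (fun y => f y * g y) x (f x * b + g x * a).
Proof. by rewrite /hasder => *; exact: is_deriveM. Qed.

Lemma der_comp f g x a b : hasder f (g x) a -> hasder g x b ->
  hasder (fun y => f (g y)) x (a * b).
Proof. by rewrite /hasder => *; exact: is_derive1_comp. Qed.

Lemma der_inv f x a : f x != 0 -> hasder f x a ->
  hasder (fun y => (f y)^-1) x (- (f x) ^- 2 * a).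
Proof. by rewrite /hasder => f0 fa; exact: is_deriveV. Qed.

Lemma der_ln f x a : 0 < f x -> hasder f x a ->
  hasder (fun y => ln (f y)) x ((f x)^-1 * a).
Proof. by move=> f0; apply: der_comp; exact: is_derive1_ln. Qed.

Lemma der_exp f x a : hasder f x a ->
  hasder (fun y => expR (f y)) x (expR (f x) * a).
Proof. by apply: der_comp; exact: is_derive_expR. Qed.

Lemma der_exprn m f x a : hasder f x a ->
  hasder (fun y => f y ^+ m) x (m%:R * f x ^+ m.-1 * a).
Proof.
move=> fa; elim: m => [|m IH]; first by rewrite !mul0r; exact: der_cst.
rewrite (_ : (fun y => _) = fun y => f y * f y ^+ m); last first.
  by apply/funext => y; rewrite exprS.
have := der_mul fa IH; congr hasder.
case: m {IH} => [|m] /=; first by rewrite expr0; ring.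
by rewrite !exprS -[in RHS]natr1; ring.
Qed.

Lemma der_sum (n : nat) (h : 'I_n -> R -> R) (d : 'I_n -> R) x :
  (forall i, hasder (h i) x (d i)) ->
  hasder (fun y => \sum_(i < n) h i y) x (\sum_(i < n) d i).
Proof.
elim: n h d => [|n IH] h d H.
  by under eq_fun do rewrite big_ord0; rewrite big_ord0; exact: der_cst.
rewrite big_ord_recr (_ : (fun y => _) =
    fun y => \sum_(i < n) h (widen_ord (leqnSn n) i) y + h ord_max y).
  by apply: der_add => //; exact: IH.
by apply/funext => y; rewrite big_ord_recr.
Qed.

Lemma der_eq f x a b : hasder f x a -> a = b -> hasder f x b.
Proof. by move=> ? <-. Qed.

Lemma der_continuous f x a : hasder f x a -> {for x, continuous f}.
Proof. by move=> [+ _] => /derivable1_diffP/differentiable_continuous. Qed.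

Lemma der_ge0_le f (df : R -> R) a b : a <= b ->
  (forall x, a <= x <= b -> hasder f x (df x)) ->
  (forall x, a < x < b -> 0 <= df x) -> f a <= f b.
Proof.
rewrite le_eqVlt => /orP[/eqP->//|ab] fd d0.
have [||c] := @MVT R f df a b ab.
- by move=> x; rewrite in_itv /= => /andP[ax xb]; apply: fd; rewrite !ltW.
- apply/continuous_in_subspaceT => x; rewrite inE /= in_itv /= => H.
  exact: der_continuous (fd x H).
rewrite in_itv /= => /d0 d; rewrite -subr_ge0 => ->.
by rewrite mulr_ge0// subr_ge0 ltW.
Qed.

Lemma der_le0_ge f (df : R -> R) a b : a <= b ->
  (forall x, a <= x <= b -> hasder f x (df x)) ->
  (forall x, a < x < b -> df x <= 0) -> f b <= f a.
Proof.
move=> ab fd d0; rewrite -lerN2.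
apply: (@der_ge0_le (fun x => - f x) (fun x => - df x)) => // x.
- by move/fd; exact: der_opp.
- by move/d0; rewrite oppr_ge0.
Qed.

End Calculus.

(** Differentiates a closed expression rule by rule; the derivative is left to be compared
    by [der_eq]. Side conditions remain for inverses and logarithms, and subterms that are not
    covered by a rule are looked up among the hypotheses. *)
Ltac der := lazymatch goal with
  | |- hasder (fun _ => ?c) _ _ => exact: der_cst
  | |- hasder (fun y => y) _ _ => exact: der_id
  | |- hasder (fun y => - _) _ _ => apply: der_opp; der
  | |- hasder (fun y => _ + _) _ _ => apply: der_add; der
  | |- hasder (fun y => _ * _) _ _ => apply: der_mul; der
  | |- hasder (fun y => _ ^+ _) _ _ => apply: der_exprn; der
  | |- hasder (fun y => _^-1) _ _ => apply: der_inv; [|der]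
  | |- hasder (fun y => ln _) _ _ => apply: der_ln; [|der]
  | |- hasder (fun y => expR _) _ _ => apply: der_exp; der
  | |- hasder (fun y => \sum_(i < _) _) _ _ => apply: der_sum => ?; der
  | |- hasder ?f ?x ?l => first [eassumption | lazymatch f with
      (fun _ => _) => fail | _ => change (hasder (fun y => f y) x l); der end]
  | _ => idtac end.

(** For side conditions of the form 0 < u or u != 0. *)
Ltac pos := first [ done | lra | assumption | apply: lt0r_neq0; pos | apply: expf_neq0; pos
  | apply: mulf_neq0; pos | apply: mulr_gt0; pos | apply: exprn_gt0; pos ].

(** * Two bounds on the logarithm *)

Section LogBounds.
Context {R : realType}.
Implicit Types (z : R).
(** With g = y - 1 and P the right-hand side, the derivative of P / y^2 - 2 ln y is
    g^3 (2/3 - 4c - 2cg) / y^3 for c = 1 / (3 (N + 1)). This value of c is the largest for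
    which the second factor stays nonnegative up to y = N, so that 1 is the minimum
    on the whole of [0, N]. *)
Lemma sqr_ln_le (N y : R) : 1 <= N -> 0 <= y <= N ->
  y ^+ 2 * ln (y ^+ 2) <= 2 * (y - 1) + 3 * (y - 1) ^+ 2 + 2 / 3 * (y - 1) ^+ 3
     - (y - 1) ^+ 4 / (3 * (N + 1)).
Proof.
move=> N1 /andP[]; rewrite le_eqVlt => /orP[/eqP<- _|y0 yN].
  rewrite expr0n mul0r sub0r.
  have c0 : (3 * (N + 1))^-1 <= 1/3 :> R by rewrite div1r lef_pV2 ?posrE; lra.
  rewrite -subr_ge0; set c := (_^-1) in c0 *; nra.
set c := (3 * (N + 1))^-1.
have cE : c * (N + 1) = 3^-1 by rewrite /c; field; pos.
pose P (y : R) : R := 2 * (y - 1) + 3 * (y - 1) ^+ 2 + 2 / 3 * (y - 1) ^+ 3 - (y - 1) ^+ 4 * c.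
pose dP (y : R) : R := 2 + 6 * (y - 1) + 2 * (y - 1) ^+ 2 - 4 * (y - 1) ^+ 3 * c.
pose h (y : R) : R := P y * (y ^+ 2)^-1 - 2 * ln y.
pose dh (y : R) : R := (y - 1) ^+ 3 * (2 / 3 - 4 * c - 2 * c * (y - 1)) * (y ^+ 3)^-1.
have dhE x : 0 < x -> hasder h x (dh x).
  move=> x0; have xn0 : x != 0 by rewrite gt_eqF.
  have dyP : hasder P x (dP x).
    by rewrite /P; apply: der_eq; [der|rewrite /dP /=; field].
  rewrite /h; apply: der_eq; first by der; pos.
  by rewrite /dh /P /dP /=; field.
have h1 : h 1 = 0 by rewrite /h /P ln1 subrr !expr0n /=; ring.
have hge : 0 <= h y.
  rewrite -h1; have [y1|y1] := leP 1 y.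
    apply: (@der_ge0_le _ h dh _ _ y1) => x /andP[x1 xy].
      by apply: dhE; lra.
    rewrite /dh; apply: mulr_ge0; last by rewrite invr_ge0 exprn_ge0; lra.
    apply: mulr_ge0; first by rewrite exprn_ge0; lra.
    have c0 : 0 < c by rewrite invr_gt0; lra.
    have : c * x <= c * N by rewrite ler_pM2l; lra.
    lra.
  apply: (@der_le0_ge _ h dh _ _ (ltW y1)) => x /andP[yx x1].
    by apply: dhE; lra.
  rewrite /dh.
  apply: mulr_le0_ge0; last by rewrite invr_ge0 exprn_ge0; lra.
  apply: mulr_le0_ge0; first by rewrite exprS; apply: mulr_le0_ge0; [lra|exact: sqr_ge0].
  have c0 : 0 < c by rewrite invr_gt0; lra.
  have : c * x <= c * 1 by rewrite ler_pM2l; lra.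
  have : c * 1 <= c * N by rewrite ler_pM2l; lra.
  lra.
have H := mulr_ge0 (sqr_ge0 y) hge; rewrite -subr_ge0 lnXn// -[_ *+ 2]mulr_natl.
apply: (le_trans H); apply: eqle; rewrite /h /P; field; pos.
Qed.

(** After division by 1 + z, the difference of the two sides has the derivative
    z^3 / ((3 + z)^2 (1 + z)^2). *)
Lemma ln1D_ge z : 0 <= z -> 3 * z ^+ 2 / (6 + 2 * z) <= (1 + z) * ln (1 + z) - z.
Proof.
move=> z0.
pose f (x : R) : R := ln (1 + x) - x * (1 + x)^-1 - 3 * x ^+ 2 * ((6 + 2 * x) * (1 + x))^-1.
pose df (x : R) : R := x ^+ 3 / ((3 + x) ^+ 2 * (1 + x) ^+ 2).
have dfE x : 0 <= x -> hasder f x (df x).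
  move=> x0; rewrite /f; apply: der_eq.
    by der; pos.
  by rewrite /df /=; field; pos.
have f0 : f 0 = 0 by rewrite /f addr0 ln1; ring.
have fz : 0 <= f z.
  rewrite -f0; apply: (@der_ge0_le _ f df _ _ z0) => x /andP[x0 _]; first exact: dfE.
  by apply: divr_ge0; [|apply: mulr_ge0]; apply: exprn_ge0; lra.
have z1 : 0 <= 1 + z by lra.
have H := mulr_ge0 z1 fz; rewrite /f in H; rewrite -subr_ge0.
apply: (le_trans H); apply: eqle; field; pos.
Qed.
End LogBounds.

(** * Fourier coefficients under doubling of the group *)

Section Fourier.
Context {R : realType}.
Implicit Types (f g : nat -> R) (z : R[i]).
Local Arguments conjc : simpl never.

(** Functions on Z_n are written here as functions on nat of which only the values below n
    matter: passing to the even or odd points is then composition with 2x or 2x + 1. *)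
Definition mean n g : R := n%:R^-1 * \sum_(x < n) g x.

Definition sqnorm z : R := complex.Re z ^+ 2 + complex.Im z ^+ 2.

Definition fourier n f k : R[i] :=
  n%:R^-1 * \sum_(x < n) (f x)%:C%C * expi (- (2 * pi * k%:R * x%:R / n%:R)).

Lemma sum_double (V : nmodType) n (G : nat -> V) :
  \sum_(k < 2 * n) G k = \sum_(k < n) (G k + G (k + n)%N).
Proof.
rewrite big_split /= mul2n -addnn big_split_ord /=.
by congr (_ + _); apply: eq_bigr => i _; rewrite addnC.
Qed.

Lemma sum_parity (V : nmodType) n (G : nat -> V) :
  \sum_(x < 2 * n) G x = \sum_(x < n) (G (2 * x)%N + G (2 * x).+1).
Proof.
elim: n => [|n IH]; first by rewrite muln0 !big_ord0.
by rewrite mulnS add2n !big_ord_recr IH /= addrA.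
Qed.

Lemma expi_pi n : expi (- (pi * n%:R) : R) = (-1) ^+ n.
Proof.
rewrite -mulNr expiMn; congr (_ ^+ _).
by rewrite /expi cosN sinN cospi sinpi oppr0 complexr0 rmorphN1.
Qed.

Lemma sqnormM z1 z2 : sqnorm (z1 * z2) = sqnorm z1 * sqnorm z2.
Proof. by case: z1 z2 => [a b] [c d]; rewrite /sqnorm /=; ring. Qed.

Lemma sqnorm_expi a : sqnorm (expi a) = 1 :> R.
Proof. by rewrite /sqnorm /expi /= cos2Dsin2. Qed.

Lemma sqnorm_real (a : R) : sqnorm a%:C%C = a ^+ 2.
Proof. by rewrite /sqnorm /=; ring. Qed.

Lemma sqnormDB z1 z2 : sqnorm (z1 + z2) + sqnorm (z1 - z2) = 2 * sqnorm z1 + 2 * sqnorm z2.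
Proof. by case: z1 z2 => [a b] [c d]; rewrite /sqnorm /=; ring. Qed.

Lemma sqnorm_ge0 z : 0 <= sqnorm z.
Proof. by rewrite addr_ge0 ?sqr_ge0. Qed.

Lemma sqnormE z : sqnorm z = complex.Re (z * z^*%C).
Proof. by case: z => a b; rewrite /sqnorm /=; ring. Qed.

Lemma parseval n (u v : 'I_n -> R[i]) :
  n%:R^-1 * \sum_x u x * (v x)^*%C = \sum_k fcoef u k * (fcoef v k)^*%C.
Proof.
under eq_bigr => x _ do rewrite -(fcoef_inv u x) mulr_suml.
rewrite exchange_big mulr_sumr; apply: eq_bigr => k _.
under eq_bigr => x _ do rewrite -mulrA.
rewrite -mulr_sumr mulrCA; congr (_ * _).
rewrite /fcoef [in RHS]rmorphM /= fmorphV /= conjc_nat rmorph_sum /=.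
congr (_ * _); apply: eq_bigr => x _.
by rewrite [in RHS]rmorphM /= conjcK mulrC.
Qed.

Lemma fourier_fcoef n f (k : 'I_n) : fourier n f k = fcoef (fun x : 'I_n => (f x)%:C%C) k.
Proof. by congr (_ * _); apply: eq_bigr => x _; rewrite expiN. Qed.

Lemma natC n : n%:R%:C%C = n%:R :> R[i].
Proof. exact: rmorph_nat. Qed.

Lemma Re_sum (I : Type) (r : seq I) (P : pred I) (F : I -> R[i]) :
  complex.Re (\sum_(i <- r | P i) F i) = \sum_(i <- r | P i) complex.Re (F i).
Proof. by elim/big_rec2: _ => // i x y _ <-; case: (F i) y => ? ? [? ?]. Qed.

Lemma parseval_fourier n f : \sum_(k < n) sqnorm (fourier n f k) = mean n (fun x => f x ^+ 2).
Proof.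
have := parseval (fun x : 'I_n => (f x)%:C%C) (fun x : 'I_n => (f x)%:C%C).
move/(congr1 (@complex.Re R)); rewrite Re_sum => E.
under eq_bigr do rewrite sqnormE fourier_fcoef.
rewrite -{}E /mean -natC -fmorphV /=.
rewrite (eq_bigr (fun x : 'I_n => (f x ^+ 2)%:C%C)); last first.
  by move=> x _; rewrite conjc_real -rmorphM /= expr2.
by rewrite -rmorph_sum -rmorphM.
Qed.

Lemma fourier0 n f : fourier n f 0 = (mean n f)%:C%C.
Proof.
rewrite /fourier /mean rmorphM /= fmorphV /= natC rmorph_sum; congr (_ * _).
by apply: eq_bigr => x _; rewrite mulr0 !mul0r oppr0 expi0 mulr1.
Qed.

(** The character of frequency m on Z_2m is (-1)^x. *)
Lemma fourier_mid m f : (0 < m)%N ->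
  fourier (2 * m) f m = (mean (2 * m) (fun x => (-1) ^+ x * f x))%:C%C.
Proof.
move=> m0; rewrite /fourier /mean rmorphM /= fmorphV /= natC rmorph_sum; congr (_ * _).
apply: eq_bigr => x _; rewrite mulrC -(_ : pi * x%:R = 2 * pi * m%:R * x%:R / (2 * m)%:R).
  by rewrite expi_pi rmorphM /= rmorphXn /= rmorphN1.
by rewrite natrM; field; rewrite pnatr_eq0 -lt0n.
Qed.

(** Characters of even frequency have period m: only the mean of f over x and x + m is seen. *)
Lemma fourier_even m f j : (0 < m)%N ->
  fourier (2 * m) f (2 * j) = fourier m (fun x => (f x + f (x + m)%N) / 2) j.
Proof.
move=> m0; have mR : m%:R != 0 :> R by rewrite pnatr_eq0 -lt0n.
set G := fun x : nat => (f x)%:C%C *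
  expi (- (2 * pi * (2 * j)%:R * x%:R / (2 * m)%:R)).
rewrite /fourier (sum_double _ G) /G.
rewrite natrM [(2 * m%:R)^-1]invfM [2^-1 * _]mulrC -[LHS]mulrA; congr (_ * _); rewrite mulr_sumr.
apply: eq_bigr => x _.
have e1 : 2 * pi * (2 * j)%:R * x%:R / (2 * m)%:R = 2 * pi * j%:R * x%:R / m%:R :> R.
  by rewrite !natrM; field.
have e2 : expi (- (2 * pi * (2 * j)%:R * (x + m)%:R / (2 * m)%:R)) =
          expi (- (2 * pi * j%:R * x%:R / m%:R) : R).
  rewrite (_ : - _ = - (2 * pi * j%:R * x%:R / m%:R) + - (pi * (2 * j)%:R)).
    by rewrite expiD expi_pi exprM sqrrN !expr1n mulr1.
  by rewrite !natrM natrD; field.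
rewrite e1 e2 -mulrDl mulrA; congr (_ * _).
by rewrite rmorphM /= rmorphD /= fmorphV /= natC mulrC.
Qed.

Section doubling.
Context (n : nat) (n0 : (0 < n)%N) (f : nat -> R).
Let nR : n%:R != 0 :> R. Proof. by rewrite pnatr_eq0 -lt0n. Qed.

Lemma expi_shift j x : expi (- (2 * pi * (j + n)%:R * x%:R / (2 * n)%:R)) =
  expi (- (2 * pi * j%:R * x%:R / (2 * n)%:R)) * (-1) ^+ x :> R[i].
Proof.
by rewrite -expi_pi -expiD; congr expi; rewrite natrD natrM; field.
Qed.

(** On even points the characters of frequencies j and j + n coincide, on odd points they are
    opposite. *)
Lemma fourier_evens j : fourier n (fun x => f (2 * x)%N) j = fourier (2 * n) f j + fourier (2 * n) f (j + n).
Proof.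
set G := fun k x : nat => (f x)%:C%C *
  expi (- (2 * pi * k%:R * x%:R / (2 * n)%:R)).
rewrite /fourier -mulrDr (sum_parity _ (G j)) (sum_parity _ (G (j + n)%N)) -big_split /G /=.
rewrite [in RHS]natrM [(2 * n%:R)^-1]invfM [2^-1 * _]mulrC -[RHS]mulrA; congr (_ * _); rewrite mulr_sumr; apply: eq_bigr => x _.
rewrite !expi_shift exprS exprM sqrrN !expr1n.
have -> : 2 * pi * j%:R * (2 * x)%:R / (2 * n)%:R = 2 * pi * j%:R * x%:R / n%:R :> R.
  by rewrite !natrM; field.
by field.
Qed.

Lemma fourier_odds j : fourier n (fun x => f (2 * x).+1) j =
  expi (pi * j%:R / n%:R) * (fourier (2 * n) f j - fourier (2 * n) f (j + n)).
Proof.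
set G := fun k x : nat => (f x)%:C%C *
  expi (- (2 * pi * k%:R * x%:R / (2 * n)%:R)).
rewrite /fourier -mulrBr (sum_parity _ (G j)) (sum_parity _ (G (j + n)%N)) -sumrB /G /=.
rewrite [in RHS]natrM [(2 * n%:R)^-1]invfM [2^-1 * _]mulrC [RHS]mulrCA -[n%:R^-1 * 2^-1 * _]mulrA; congr (_ * _).
rewrite !mulr_sumr; apply: eq_bigr => x _.
rewrite !expi_shift exprS exprM sqrrN !expr1n.
rewrite (_ : - (2 * pi * j%:R * x%:R / n%:R) =
  pi * j%:R / n%:R + - (2 * pi * j%:R * (2 * x).+1%:R / (2 * n)%:R)); last first.
  by rewrite -addn1 natrD !natrM; field.
by rewrite expiD; field.
Qed.
End doubling.
End Fourier.

(** * The polynomial inequalities behind Z_4 and Z_6 *)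

Section Poly.
Context {R : realFieldType}.
Implicit Types a b c e h k x z : R.

(** The tangent at z = 4 of the defect left by [ln1D_ge]. *)
Lemma entropy_defect_tangent z : 0 <= z ->
  60 / 49 * z - 72 / 49 <= 3 * z ^+ 2 / (6 + 2 * z).
Proof.
move=> z0; rewrite ler_pdivlMr; last by lra.
by have := sqr_ge0 (z - 4); nra.
Qed.

Lemma entropy_defect_ge z : 0 <= z <= 3 -> z ^+ 2 / 4 <= 3 * z ^+ 2 / (6 + 2 * z).
Proof.
move=> /andP[z0 z3]; rewrite ler_pdivlMr; last by lra.
by have := mulr_ge0 (sqr_ge0 z) (_ : 0 <= 3 - z); nra.
Qed.

(** On Z_4, x is the modulus of the coefficient of frequency 2 and H the energy of the
    frequencies 1 and 3. Once x^3 is bounded below by x (x - 2z/5)^2 >= 0, a quadratic form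
    in x and z remains, with coefficients depending on z and nonpositive discriminant for z <= 3. *)
Lemma Z4_polynomial_ge0 x H : 0 <= x <= 1 -> 0 <= H <= 1 + x ^+ 2 ->
  forall z, z = H + x ^+ 2 ->
  0 <= 4 / 3 * x ^+ 2 - 26 / 15 * x * H + z ^+ 2 / 15 + 3 * z ^+ 2 / (6 + 2 * z).
Proof.
move=> /andP[x0 x1] /andP[H0 H1] z zE.
have z0 : 0 <= z by rewrite zE addr_ge0 ?sqr_ge0.
have z3 : z <= 3 by rewrite zE; nra.
have zp : 0 < 6 + 2 * z by lra.
pose u := (6 + 2 * z)^-1.
have uE : u * (6 + 2 * z) = 1 by rewrite /u mulVf ?gt_eqF.
have u0 : 0 < u by rewrite invr_gt0.
pose A := 4 / 3 + 104 / 75 * z.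
pose B := 26 / 15 * (1 + 4 / 25 * z).
pose C := 1 / 15 + 3 * u.
have A0 : 0 < A by rewrite /A; lra.
have disc : B ^+ 2 <= 4 * A * C.
  rewrite -(ler_pM2r zp).
  have -> : 4 * A * C * (6 + 2 * z) = 4 * A * ((6 + 2 * z) / 15 + 3).
    transitivity (4 * A * ((6 + 2 * z) / 15 + 3 * (u * (6 + 2 * z)))); first by rewrite /C; field.
    by rewrite uE mulr1.
  have z3' : 0 <= 3 - z by lra.
  have := mulr_ge0 z0 z3'; have := mulr_ge0 (mulr_ge0 z0 z0) z3'.
  rewrite /A /B; nra.
have quad : 0 <= A * x ^+ 2 - B * z * x + C * z ^+ 2.
  have : 0 <= 4 * A * (A * x ^+ 2 - B * z * x + C * z ^+ 2).
    have -> : 4 * A * (A * x ^+ 2 - B * z * x + C * z ^+ 2) =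
      (2 * A * x - B * z) ^+ 2 + (4 * A * C - B ^+ 2) * z ^+ 2 by ring.
    by rewrite addr_ge0 ?sqr_ge0// mulr_ge0 ?sqr_ge0// subr_ge0.
  by rewrite pmulr_rge0//; lra.
(* x^3 >= (4/5) z x^2 - (4/25) z^2 x *)
have cub := mulr_ge0 x0 (sqr_ge0 (x - 2 / 5 * z)).
rewrite -/u; move: quad; rewrite /A /B /C.
have -> : H = z - x ^+ 2 by rewrite zE; ring.
nra.
Qed.

(** On Z_6, the parameters a, b, c are the moduli of the coefficients of frequencies 1, 2, 3. When z <= 3
    the quotient 3 z^2 / (6 + 2z) is at least z^2 / 4, and the bound is a sum of squares. When z
    is larger it is replaced by its tangent; then b >= 7/10, the terms a^2 + 2ac - c^2 are at
    most 25/32 (2a^2 + c^2), and a cubic in b remains, concave on [7/10, 1]. *)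
Lemma Z6_polynomial_ge0 a b c : 0 <= a -> 0 <= b <= 1 -> 2 * a ^+ 2 + c ^+ 2 <= 1 + 2 * b ^+ 2 ->
  forall z, z = 2 * a ^+ 2 + 2 * b ^+ 2 + c ^+ 2 ->
  0 <= 22 / 7 * b ^+ 2 + 18 / 5 * c ^+ 2 + z ^+ 2 / 21 + 3 * z ^+ 2 / (6 + 2 * z)
     - 16 / 21 * b ^+ 3 - 24 / 7 * (a ^+ 2 * b + 2 * (a * b * c)).
Proof.
move=> a0 /andP[b0 b1] wb z zE.
have z0 : 0 <= z by rewrite zE; have := sqr_ge0 a; have := sqr_ge0 b; have := sqr_ge0 c; lra.
have [z3|z3] := leP z 3.
  have := entropy_defect_ge (introT andP (conj z0 z3)).
  have := sqr_ge0 (c - 13 / 16 * (a * b)).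
  have := sqr_ge0 (a ^+ 2 - 36 / 25 * b).
  have := sqr_ge0 (a * c - 423 / 1000 * b).
  have := sqr_ge0 (b ^+ 2 - 8 / 25 * b).
  have := sqr_ge0 (a * b); have := sqr_ge0 (b * c); have := sqr_ge0 (c ^+ 2).
  have := sqr_ge0 b; rewrite zE; lra.
have := entropy_defect_tangent z0.
have w0 := mulr_ge0 b0 (sqr_ge0 (9 / 16 * a - c)).
have b7 : 7 / 10 <= b by rewrite zE in z3; nra.
have cb : 0 <= c ^+ 2 * (1 - b) by rewrite mulr_ge0 ?sqr_ge0//; lra.
set w := 2 * a ^+ 2 + c ^+ 2 in wb.
(* the value at the end point 2a^2 + c^2 = 1 + 2b^2; the coefficient of 2a^2 + c^2 is negative *)
have p : 0 <= - 92 / 147 - 75 / 28 * b + (22 / 7 + 944 / 147) * b ^+ 2 - (16 / 21 + 75 / 14) * b ^+ 3.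
  (* a concave function on [7/10, 1], nonnegative at both ends *)
  have : 0 <= (b - 7 / 10) * (1 - b) by rewrite mulr_ge0//; lra.
  by nra.
have bw : 0 <= (b - 7 / 10) * (1 + 2 * b ^+ 2 - w) by rewrite mulr_ge0//; lra.
have := sqr_ge0 (z - 4).
have -> : z = w + 2 * b ^+ 2 by rewrite zE /w; ring.
have : b * (2 * a ^+ 2 + c ^+ 2) = b * w by [].
have : 2 * a ^+ 2 + c ^+ 2 = w by [].
have := sqr_ge0 c; have := mulr_ge0 b0 (sqr_ge0 c); have := mulr_ge0 b0 (sqr_ge0 a).
lra.
Qed.
End Poly.

(** * Entropy and moments *)

Section Base.
Context {R : realType}.
Implicit Types (f g : nat -> R).

Definition entropy n f : R := mean n (fun x => f x ^+ 2 * ln (f x ^+ 2))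
  - mean n (fun x => f x ^+ 2) * ln (mean n (fun x => f x ^+ 2)).

(** The logarithmic Sobolev inequality on Z_n in which the energy n/2 of the frequency n/2 is
    diminished by d; the inequality itself is the case d = 0. *)
Definition log_sob n (d : R) := forall f, (forall x, 0 <= f x) ->
  entropy n f <= 2 * \sum_(k < n) (minn k (n - k))%:R * sqnorm (fourier n f k)
             - 2 * d * sqnorm (fourier n f n./2).

Lemma eq_mean n f g : (forall x, (x < n)%N -> f x = g x) -> mean n f = mean n g.
Proof. by move=> fg; congr (_ * _); apply: eq_bigr => x _; exact: fg. Qed.

Lemma mean_le n f g : (forall x, (x < n)%N -> f x <= g x) -> mean n f <= mean n g.
Proof.
by move=> fg; apply: ler_wpM2l; [rewrite invr_ge0|apply: ler_sum => x _; exact: fg].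
Qed.

Lemma meanD n f g : mean n (fun x => f x + g x) = mean n f + mean n g.
Proof. by rewrite /mean big_split mulrDr. Qed.

Lemma meanZ n c f : mean n (fun x => c * f x) = c * mean n f.
Proof. by rewrite /mean -mulr_sumr mulrCA. Qed.

Lemma meanN n f : mean n (fun x => - f x) = - mean n f.
Proof. by rewrite /mean sumrN mulrN. Qed.

Lemma mean_cst n (c : R) : (0 < n)%N -> mean n (fun=> c) = c.
Proof.
move=> n0; rewrite /mean sumr_const card_ord -[c *+ n]mulr_natl mulKf//.
by rewrite pnatr_eq0 -lt0n.
Qed.

Lemma mean_ge0 n f : (forall x, (x < n)%N -> 0 <= f x) -> 0 <= mean n f.
Proof. by move=> f0; rewrite mulr_ge0 ?invr_ge0//; apply: sumr_ge0 => x _; exact: f0. Qed.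

Definition meanE := (meanD, meanN, meanZ).

(** The pointwise bound is taken with N = n: a nonnegative function of mean 1 on n points is
    at most n. *)
Lemma entropy_le_moments n f : (0 < n)%N -> (forall x, 0 <= f x) -> mean n f = 1 ->
  forall z, z = mean n (fun x => (f x - 1) ^+ 2) ->
  entropy n f <= 2 * z + 2 / 3 * mean n (fun x => (f x - 1) ^+ 3)
    - mean n (fun x => (f x - 1) ^+ 4) / (3 * (n%:R + 1)) - 3 * z ^+ 2 / (6 + 2 * z).
Proof.
move=> n0 f0 f1 z zE; have nR : 1 <= n%:R :> R by rewrite ler1n.
have fn x : (x < n)%N -> 0 <= f x <= n%:R.
  move=> xn; rewrite f0 /=; have : \sum_(i < n) f i = n%:R.
    by rewrite -[LHS](mulVKf (_ : n%:R != 0)) ?[_^-1 * _]f1 ?mulr1//; rewrite gt_eqF//; lra.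
  move=> <-; rewrite (bigD1 (Ordinal xn))//= lerDl; apply: sumr_ge0 => i _; exact: f0.
have z0 : 0 <= z by rewrite zE mean_ge0// => x _; exact: sqr_ge0.
have f2 : mean n (fun x => f x ^+ 2) = 1 + z.
  transitivity (mean n (fun x => (f x - 1) ^+ 2 + (2 * (f x - 1) + 1))).
    by apply: eq_mean => x _; ring.
  by rewrite !meanE !mean_cst// -zE f1; ring.
rewrite /entropy f2.
have le1 : mean n (fun x => f x ^+ 2 * ln (f x ^+ 2)) <= 3 * z +
    2 / 3 * mean n (fun x => (f x - 1) ^+ 3)
    - mean n (fun x => (f x - 1) ^+ 4) / (3 * (n%:R + 1)).
  apply: (@le_trans _ _ (mean n (fun x => 2 * (f x - 1) + 3 * (f x - 1) ^+ 2
    + 2 / 3 * (f x - 1) ^+ 3 + (- (3 * (n%:R + 1))^-1) * (f x - 1) ^+ 4))).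
    apply: mean_le => x xn; rewrite mulNr [_^-1 * _]mulrC.
    by apply: sqr_ln_le => //; exact: fn.
  rewrite !meanE !mean_cst// f1 -zE; apply: eqle; ring.
have := ln1D_ge z0; lra.
Qed.

Lemma mean_sqr_scale n c f : mean n (fun x => (c * f x) ^+ 2) = c ^+ 2 * mean n (fun x => f x ^+ 2).
Proof. by rewrite -meanZ; apply: eq_mean => x _; rewrite exprMn. Qed.

Lemma entropy_scale n c f : 0 < c -> (forall x, 0 <= f x) ->
  entropy n (fun x => c * f x) = c ^+ 2 * entropy n f.
Proof.
move=> c0 f0; have c2 : 0 < c ^+ 2 by rewrite exprn_gt0.
have key (u : R) : 0 <= u -> c ^+ 2 * u * ln (c ^+ 2 * u) = c ^+ 2 * ln (c ^+ 2) * u + c ^+ 2 * (u * ln u).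
  rewrite le_eqVlt => /orP[/eqP<-|u0]; first by ring.
  by rewrite lnM ?posrE//; ring.
rewrite /entropy mean_sqr_scale key; last by apply: mean_ge0 => x _; exact: sqr_ge0.
rewrite (@eq_mean _ _ (fun x => c ^+ 2 * ln (c ^+ 2) * f x ^+ 2 + c ^+ 2 * (f x ^+ 2 * ln (f x ^+ 2)))).
  by rewrite !meanE; ring.
by move=> x _; rewrite exprMn key// sqr_ge0.
Qed.

Lemma fourier_scale n c f k : fourier n (fun x => c * f x) k = c%:C%C * fourier n f k.
Proof.
rewrite /fourier [RHS]mulrCA [in RHS]mulr_sumr; congr (_ * _); apply: eq_bigr => x _.
by rewrite rmorphM /= mulrA.
Qed.

Lemma log_sob_normalized n d : (0 < n)%N ->
  (forall f, (forall x, 0 <= f x) -> mean n f = 1 ->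
    entropy n f <= 2 * \sum_(k < n) (minn k (n - k))%:R * sqnorm (fourier n f k)
             - 2 * d * sqnorm (fourier n f n./2)) -> log_sob n d.
Proof.
move=> n0 H f f0; have nR : n%:R != 0 :> R by rewrite pnatr_eq0 -lt0n.
have : 0 <= mean n f by apply: mean_ge0 => x _; exact: f0.
rewrite le_eqVlt => /orP[/eqP fm|m0].
  have fz x : (x < n)%N -> f x = 0.
    move=> xn; have /eqP : n%:R^-1 * \sum_(i < n) f i = 0 by rewrite [RHS]fm.
    rewrite mulf_eq0 invr_eq0 (negPf nR) /= psumr_eq0; last by move=> i _; exact: f0.
    by move=> /allP/(_ (Ordinal xn) (mem_index_enum _))/eqP.
  have Fz k : sqnorm (fourier n f k) = 0.
    rewrite /fourier big1 ?mulr0; first by rewrite /sqnorm /=; ring.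
    by move=> x _; rewrite fz// mul0r.
  rewrite Fz mulr0 subr0 big1 => [|k _]; last by rewrite Fz mulr0.
  rewrite /entropy !(@eq_mean _ _ (fun=> 0)) ?mean_cst// => [|x xn|x xn].
  - by rewrite mul0r subr0 mulr0.
  - by rewrite fz// expr0n.
  - by rewrite fz// expr0n mul0r.
have c0 : 0 < (mean n f)^-1 by rewrite invr_gt0.
have := H (fun x => (mean n f)^-1 * f x).
rewrite entropy_scale// meanZ mulVf ?gt_eqF// => /(_ _ erefl).
rewrite fourier_scale sqnormM sqnorm_real; under eq_bigr do rewrite fourier_scale sqnormM sqnorm_real mulrCA.
rewrite -mulr_sumr mulrCA [2 * d * _]mulrCA -mulrBr ler_pM2l ?exprn_gt0//; apply => x.
by rewrite mulr_ge0// ltW.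
Qed.

(** On two points f - 1 takes opposite values, so that its third moment vanishes. *)
Lemma log_sob_Z2 : log_sob 2 0.
Proof.
apply: log_sob_normalized => // f f0 f1.
have := entropy_le_moments (isT : (0 < 2)%N) f0 f1 erefl; set z := mean 2 _.
have z0 : 0 <= z by apply: mean_ge0 => x _; exact: sqr_ge0.
have E := parseval_fourier 2 f; have F0 := fourier0 2 f.
rewrite !big_ord_recr !big_ord0 /= in E *.
rewrite !add0r F0 sqnorm_real f1 expr1n in E *.
have f12 : f 1 = 2 - f 0.
  by move: f1; rewrite /mean !big_ord_recr big_ord0 /=; lra.
have sE : sqnorm (fourier 2 f 1) = z.
  suff : 1 + z = mean 2 (fun x => f x ^+ 2) by lra.
  by rewrite /z /mean !big_ord_recr !big_ord0 /= f12; field.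
have -> : mean 2 (fun x => (f x - 1) ^+ 3) = 0.
  by rewrite /mean !big_ord_recr big_ord0 /= f12; field.
have m4 : 0 <= mean 2 (fun x => (f x - 1) ^+ 4) / (3 * (2%:R + 1)).
  by apply: divr_ge0; [apply: mean_ge0 => x _; exact: exprn_even_ge0|lra].
have dz : 0 <= 3 * z ^+ 2 / (6 + 2 * z).
  by apply: divr_ge0; [rewrite mulr_ge0 ?sqr_ge0|lra].
rewrite sE -[minn 0 _]/0%N -[minn 1 _]/1%N; lra.
Qed.

(** The case n = 2, read as a bound on the entropy of a pair of squared norms. *)
Lemma two_point (A B : R) : 0 <= A -> 0 <= B ->
  (A ^+ 2 * ln (A ^+ 2) + B ^+ 2 * ln (B ^+ 2)) / 2
  - (A ^+ 2 + B ^+ 2) / 2 * ln ((A ^+ 2 + B ^+ 2) / 2) <= (A - B) ^+ 2 / 2.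
Proof.
move=> A0 B0; pose f x : R := if x is 0%N then A else B.
have f0 x : 0 <= f x by case: x.
have := log_sob_Z2 f0; rewrite mulr0 mul0r subr0.
have := fourier_mid f (isT : (0 < 1)%N); rewrite muln1 => F1.
rewrite /entropy /mean !big_ord_recr !big_ord0 /= F1 sqnorm_real.
rewrite /mean !big_ord_recr !big_ord0 /= -[minn 0 _]/0%N -[minn 1 _]/1%N /= !add0r.
rewrite [2^-1 * (A ^+ 2 + B ^+ 2)]mulrC expr0 expr1 => H.
by apply: (le_trans (eqle _) (le_trans H (eqle _))); field.
Qed.

(** The defect is the discriminant of the cubic with roots e0, e1, e2. *)
Lemma three_point_cubic (e0 e1 e2 : R) : e0 + e1 + e2 = 0 ->
  ((e0 ^+ 3 + e1 ^+ 3 + e2 ^+ 3) / 3) ^+ 2 <= ((e0 ^+ 2 + e1 ^+ 2 + e2 ^+ 2) / 3) ^+ 3 / 2.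
Proof.
move=> s0; rewrite -subr_ge0.
have -> : ((e0 ^+ 2 + e1 ^+ 2 + e2 ^+ 2) / 3) ^+ 3 / 2 - ((e0 ^+ 3 + e1 ^+ 3 + e2 ^+ 3) / 3) ^+ 2
  = ((e0 - e1) * (e1 - e2) * (e2 - e0)) ^+ 2 / 27.
  by rewrite (_ : e2 = - e0 - e1); [field|lra].
by rewrite divr_ge0 ?sqr_ge0.
Qed.

(** If e and k have coefficients u, v at frequency 1 on Z_3, the left-hand side is
    (2 Re (u conj v))^2 and the defect is (2 Im (u conj v))^2. In the next lemma the same holds
    with u v^2. *)
Lemma three_point_bilinear (e0 e1 e2 k0 k1 k2 : R) : e0 + e1 + e2 = 0 -> k0 + k1 + k2 = 0 ->
  ((e0 * k0 + e1 * k1 + e2 * k2) / 3) ^+ 2 <=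
  (e0 ^+ 2 + e1 ^+ 2 + e2 ^+ 2) / 3 * ((k0 ^+ 2 + k1 ^+ 2 + k2 ^+ 2) / 3).
Proof.
move=> e_0 k_0; rewrite -subr_ge0.
set X := (X in 0 <= X).
have -> : X = (e0 * (k1 - k2) + e1 * (k2 - k0) + e2 * (k0 - k1)) ^+ 2 / 27.
  rewrite /X (_ : e2 = - e0 - e1); last by lra.
  by rewrite (_ : k2 = - k0 - k1); [field|lra].
by rewrite divr_ge0 ?sqr_ge0.
Qed.

Lemma three_point_quadratic (e0 e1 e2 k0 k1 k2 : R) : e0 + e1 + e2 = 0 -> k0 + k1 + k2 = 0 ->
  ((e0 * k0 ^+ 2 + e1 * k1 ^+ 2 + e2 * k2 ^+ 2) / 3) ^+ 2 <=
  (e0 ^+ 2 + e1 ^+ 2 + e2 ^+ 2) / 3 * ((k0 ^+ 2 + k1 ^+ 2 + k2 ^+ 2) / 3) ^+ 2 / 2.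
Proof.
move=> e_0 k_0; rewrite -subr_ge0.
set X := (X in 0 <= X).
have -> : X = (e0 * (k1 ^+ 2 - k2 ^+ 2) + e1 * (k2 ^+ 2 - k0 ^+ 2)
               + e2 * (k0 ^+ 2 - k1 ^+ 2)) ^+ 2 / 27.
  rewrite /X (_ : e2 = - e0 - e1); last by lra.
  by rewrite (_ : k2 = - k0 - k1); [field|lra].
by rewrite divr_ge0 ?sqr_ge0.
Qed.

(** A function 1 + g on Z_4 is decomposed as g = (b + h0, -b + h1, b - h0, -b - h1): b is the
    coefficient of frequency 2, and h0, h1 carry the frequencies 1 and 3. The third moment is
    3 b (h0^2 - h1^2) / 2; part of it is absorbed by the fourth moment, which is where the
    square of D - 2b comes from. *)
Lemma Z4_moment_bound (b h0 h1 : R) : -1 <= b <= 1 ->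
  h0 ^+ 2 <= (1 + b) ^+ 2 -> h1 ^+ 2 <= (1 - b) ^+ 2 ->
  forall M, (forall m, M m =
    ((b + h0) ^+ m + (- b + h1) ^+ m + (b - h0) ^+ m + (- b - h1) ^+ m) / 4) ->
  2 * M 2%N + 2 / 3 * M 3%N - M 4%N / 15 - 3 * M 2%N ^+ 2 / (6 + 2 * M 2%N) <=
  2 * ((h0 ^+ 2 + h1 ^+ 2) / 2 + 2 * b ^+ 2) - 2 / 5 * b ^+ 2.
Proof.
move=> /andP[b1 b1'] b0 b2 M ME.
pose H := (h0 ^+ 2 + h1 ^+ 2) / 2; pose D := (h0 ^+ 2 - h1 ^+ 2) / 2.
have H0 : 0 <= H by have := sqr_ge0 h0; have := sqr_ge0 h1; rewrite /H; lra.
have H1 : H <= 1 + `|b| ^+ 2 by rewrite real_normK ?num_real// /H; lra.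
have DH : `|D| <= H by rewrite ler_norml /D /H; have := sqr_ge0 h0; have := sqr_ge0 h1; lra.
have bb : 0 <= `|b| <= 1 by rewrite normr_ge0 ler_norml b1.
have zE : M 2%N = H + `|b| ^+ 2 by rewrite real_normK ?num_real// ME /H; field.
have := Z4_polynomial_ge0 bb (introT andP (conj H0 H1)) zE; rewrite zE.
set z := H + _; set u := 3 * z ^+ 2 / _.
have -> : M 3%N = 3 * (b * D) by rewrite ME /D; field.
have -> : M 4%N = z ^+ 2 + 4 * b ^+ 2 * H + D ^+ 2.
  by rewrite ME /z /H /D real_normK ?num_real//; field.
have bD : b * D <= `|b| * H.
  by rewrite (le_trans (ler_norm _))// normrM ler_wpM2l.
have := sqr_ge0 (D - 2 * b); have := mulr_ge0 (sqr_ge0 b) H0.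
rewrite -[(_ + _) / 2]/H /z real_normK ?num_real//.
lra.
Qed.

(** A function 1 + g on Z_6 takes the values 1 + e_i + h_i and 1 + e_i - h_i on the pairs
    {x, x + 3}: the e_i carry the even frequencies, the h_i the odd ones, and c is the coefficient
    of frequency 3. The third moment involves h only through E(e h^2), since the square of the
    frequency 3 part is constant. The fourth moment is bounded below by
    expanding E(g^2 - E(g^2) - 3e)^2 >= 0, which cancels part of the third moment. *)
Lemma Z6_moment_bound (e0 e1 e2 h0 h1 h2 : R) : e0 + e1 + e2 = 0 ->
  `|h0| <= 1 + e0 -> `|h1| <= 1 + e1 -> `|h2| <= 1 + e2 ->
  forall M, (forall m, M m = ((e0 + h0) ^+ m + (e0 - h0) ^+ m + (e1 + h1) ^+ m
    + (e1 - h1) ^+ m + (e2 + h2) ^+ m + (e2 - h2) ^+ m) / 6) ->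
  forall c, c = (h0 + h1 + h2) / 3 ->
  2 * M 2%N + 2 / 3 * M 3%N - M 4%N / 21 - 3 * M 2%N ^+ 2 / (6 + 2 * M 2%N) <=
  2 * ((h0 ^+ 2 + h1 ^+ 2 + h2 ^+ 2) / 3 + 2 * ((e0 ^+ 2 + e1 ^+ 2 + e2 ^+ 2) / 3) + 2 * c ^+ 2)
  - 2 / 5 * c ^+ 2.
Proof.
move=> e_0 he0 he1 he2 M ME c cE.
have nsq (x y : R) : `|x| <= y -> x ^+ 2 <= y ^+ 2.
  by move=> xy; rewrite -real_normK ?num_real// lerXn2r ?nnegrE// (le_trans _ xy).
have sle (x y : R) : 0 <= y -> x ^+ 2 <= y ^+ 2 -> `|x| <= y.
  by move=> y0 xy; rewrite -ler_sqr ?nnegrE// real_normK ?num_real.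
pose S := (e0 ^+ 2 + e1 ^+ 2 + e2 ^+ 2) / 3.
pose k0 := h0 - c; pose k1 := h1 - c; pose k2 := h2 - c.
have k_0 : k0 + k1 + k2 = 0 by rewrite /k0 /k1 /k2 cE; field.
pose K := (k0 ^+ 2 + k1 ^+ 2 + k2 ^+ 2) / 3.
pose H := (h0 ^+ 2 + h1 ^+ 2 + h2 ^+ 2) / 3.
have HE : H = K + c ^+ 2 by rewrite /H /K /k0 /k1 /k2 cE; field.
have S0 : 0 <= S by rewrite /S; have := sqr_ge0 e0; have := sqr_ge0 e1; have := sqr_ge0 e2; lra.
have K0 : 0 <= K by rewrite /K; have := sqr_ge0 k0; have := sqr_ge0 k1; have := sqr_ge0 k2; lra.
have e0_ : 0 <= 1 + e0 by exact: le_trans (normr_ge0 _) he0.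
have e1_ : 0 <= 1 + e1 by exact: le_trans (normr_ge0 _) he1.
have e2_ : 0 <= 1 + e2 by exact: le_trans (normr_ge0 _) he2.
have S2 : S <= 2.
  rewrite /S; have := mulr_ge0 e0_ e1_; have := mulr_ge0 e0_ e2_; have := mulr_ge0 e1_ e2_.
  have -> : e2 = - e0 - e1 by lra. nra.
have HS : H <= 1 + S.
  have := nsq _ _ he0; have := nsq _ _ he1; have := nsq _ _ he2; rewrite /H /S; lra.
pose a := Num.sqrt (K / 2); pose b := Num.sqrt (S / 2).
have a2 : a ^+ 2 = K / 2 by rewrite sqr_sqrtr// divr_ge0.
have b2 : b ^+ 2 = S / 2 by rewrite sqr_sqrtr// divr_ge0.
have a0 : 0 <= a by exact: sqrtr_ge0.
have b0 : 0 <= b by exact: sqrtr_ge0.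
have b1 : b <= 1 by rewrite -(@ler_sqr _ b 1) ?nnegrE// b2 expr1n; lra.
have c2 : `|c| ^+ 2 = c ^+ 2 by rewrite real_normK ?num_real.
have w1 : 2 * a ^+ 2 + `|c| ^+ 2 <= 1 + 2 * b ^+ 2 by rewrite a2 b2 c2; lra.
have zE : M 2%N = 2 * a ^+ 2 + 2 * b ^+ 2 + `|c| ^+ 2.
  rewrite a2 b2 c2 (_ : 2 * (K / 2) + _ + c ^+ 2 = H + S); last by rewrite HE; field.
  by rewrite ME /H /S; field.
have := Z6_polynomial_ge0 a0 (introT andP (conj b0 b1)) w1 zE; set u := 3 * _ / _.
pose E3 := (e0 ^+ 3 + e1 ^+ 3 + e2 ^+ 3) / 3.
pose Eek := (e0 * k0 + e1 * k1 + e2 * k2) / 3.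
pose Ekk := (e0 * k0 ^+ 2 + e1 * k1 ^+ 2 + e2 * k2 ^+ 2) / 3.
have E3b : E3 <= 2 * b ^+ 3.
  apply: (le_trans (ler_norm _)); apply: sle; first by rewrite mulr_ge0 ?exprn_ge0.
  apply: (le_trans (three_point_cubic e_0)); apply: eqle.
  have -> : (2 * b ^+ 3) ^+ 2 = 4 * (b ^+ 2) ^+ 3 by ring.
  by rewrite b2 /S; field.
have Ekb : Eek * c <= 2 * (a * b * `|c|).
  apply: (le_trans (ler_norm _)); rewrite normrM mulrA ler_wpM2r//.
  apply: sle; first by rewrite !mulr_ge0.
  apply: (le_trans (three_point_bilinear e_0 k_0)); apply: eqle.
  have -> : (2 * (a * b)) ^+ 2 = 4 * a ^+ 2 * b ^+ 2 by ring.
  by rewrite a2 b2 /S /K; field.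
have Ekkb : Ekk <= 2 * (a ^+ 2 * b).
  apply: (le_trans (ler_norm _)); apply: sle; first by rewrite !mulr_ge0 ?exprn_ge0.
  apply: (le_trans (three_point_quadratic e_0 k_0)); apply: eqle.
  have -> : (2 * (a ^+ 2 * b)) ^+ 2 = 4 * (a ^+ 2) ^+ 2 * b ^+ 2 by ring.
  by rewrite a2 b2 /S /K; field.
pose W := 2 * c * Eek + Ekk.
have WE : (e0 * h0 ^+ 2 + e1 * h1 ^+ 2 + e2 * h2 ^+ 2) / 3 = W.
  rewrite /W /Eek /Ekk /k0 /k1 /k2.
  have -> : e2 = - e0 - e1 by lra. by field.
have M3 : M 3%N = E3 + 3 * W by rewrite -WE ME /E3; field.
have M4 : M 2%N ^+ 2 + 6 * (E3 + W) - 9 * S <= M 4%N.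
  pose d (e h : R) := (e ^+ 2 + h ^+ 2 - M 2%N - 3 * e) ^+ 2 + 4 * (e * h) ^+ 2.
  have d0 e h : 0 <= d e h.
    have := sqr_ge0 (e ^+ 2 + h ^+ 2 - M 2%N - 3 * e); have := sqr_ge0 (e * h).
    rewrite /d; lra.
  rewrite -subr_ge0 (_ : _ - _ = (d e0 h0 + d e1 h1 + d e2 h2) / 3).
    by apply: divr_ge0 => //; do 2 apply: addr_ge0 => //.
  rewrite -WE /d /E3 /S (_ : M 2%N = H + S); last by rewrite ME /H /S; field.
  rewrite /H /S ME; have -> : e2 = - e0 - e1 by lra. by field.
rewrite -[(h0 ^+ 2 + _ + _) / 3]/H -[(e0 ^+ 2 + _ + _) / 3]/S M3.
have -> : H = M 2%N - S by rewrite ME /H /S; field.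
move: M4 Ekb Ekkb E3b; rewrite c2 /W b2; set z := M 2%N; rewrite -/z.
lra.
Qed.
End Base.

(** * The logarithmic Sobolev inequality on Z_4 and Z_6 *)

Section Doubling.
Context {R : realType}.
Implicit Types (f g : nat -> R).

(** Every squared coefficient is a combination of moments of f and of the means of f over
    {x, x + 2}, by Parseval on Z_4 and on Z_2; no value of a character is computed. *)
Lemma log_sob_Z4 : log_sob 4 (5^-1 : R).
Proof.
apply: log_sob_normalized => // f f0 f1.
set s := fun k => sqnorm (fourier 4 f k).
have E := parseval_fourier 4 f; have F0 : s 0 = 1 by rewrite /s fourier0 sqnorm_real f1 expr1n.
have F2 : s 2 = (((f 0 + f 2) / 2 - (f 1 + f 3) / 2) / 2) ^+ 2.
  rewrite /s -[4%N]/(2 * 2)%N -[X in fourier _ _ X]/(2 * 1)%N fourier_even// -[X in fourier X _ _]/(2 * 1)%N.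
  rewrite fourier_mid// sqnorm_real /mean !big_ord_recr big_ord0 /=.
  by congr (_ ^+ 2); field.
rewrite !big_ord_recr !big_ord0 /= -![sqnorm _]/(s _) in E *.
pose b := (f 0 + f 2) / 2 - 1; pose h0 := (f 0 - f 2) / 2; pose h1 := (f 1 - f 3) / 2.
have f4 : f 3 = 4 - f 0 - f 1 - f 2.
  by move: f1; rewrite /mean !big_ord_recr big_ord0 /=; lra.
have [g0 g1 g2 g3] : [/\ f 0 - 1 = b + h0, f 1 - 1 = - b + h1, f 2 - 1 = b - h0 & f 3 - 1 = - b - h1].
  by rewrite /b /h0 /h1; split; lra.
have [p0 p1 p2 p3] : [/\ 0 <= f 0, 0 <= f 1, 0 <= f 2 & 0 <= f 3] by [].
have b1 : -1 <= b <= 1 by lra.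
have q0 : h0 ^+ 2 <= (1 + b) ^+ 2 by have := mulr_ge0 p0 p2; rewrite /h0 /b; lra.
have q1 : h1 ^+ 2 <= (1 - b) ^+ 2.
  by have := mulr_ge0 p1 p3; rewrite (_ : 1 - b = (f 1 + f 3) / 2) /h1; [lra|rewrite /b; lra].
have ME m : mean 4 (fun x => (f x - 1) ^+ m) =
    ((b + h0) ^+ m + (- b + h1) ^+ m + (b - h0) ^+ m + (- b - h1) ^+ m) / 4.
  by rewrite /mean !big_ord_recr big_ord0 /= g0 g1 g2 g3; field.
have := entropy_le_moments (isT : (0 < 4)%N) f0 f1 erefl.
have := Z4_moment_bound b1 q0 q1 ME.
have -> : 3 * (4%:R + 1) = 15 :> R by ring.
have s13 : s 1 + s 3 = (h0 ^+ 2 + h1 ^+ 2) / 2.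
  move: E; rewrite F0 F2 /mean !big_ord_recr big_ord0 /= /h0 /h1 f4; lra.
have -> : s 2 = b ^+ 2 by rewrite F2 /b f4; field.
rewrite -[minn 0 _]/0%N -[minn 1 _]/1%N -[minn 2 _]/2%N -[minn 3 _]/1%N.
lra.
Qed.

Lemma log_sob_Z6 : log_sob 6 (5^-1 : R).
Proof.
apply: log_sob_normalized => // f f0 f1.
set s := fun k => sqnorm (fourier 6 f k).
have E := parseval_fourier 6 f; have F0 : s 0 = 1 by rewrite /s fourier0 sqnorm_real f1 expr1n.
have F3 : s 3 = ((f 0 - f 1 + f 2 - f 3 + f 4 - f 5) / 6) ^+ 2.
  rewrite /s -[6%N]/(2 * 3)%N fourier_mid// sqnorm_real /mean !big_ord_recr big_ord0 /=.
  by congr (_ ^+ 2); field.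
have E3 := parseval_fourier 3 (fun x => (f x + f (x + 3)%N) / 2).
rewrite !big_ord_recr !big_ord0 /= -!fourier_even// in E3.
rewrite !big_ord_recr !big_ord0 /= -![sqnorm _]/(s _) in E E3 *.
rewrite /mean !big_ord_recr !big_ord0 /= in E E3.
rewrite -[(0 + 3)%N]/3%N -[(1 + 3)%N]/4%N -[(2 + 3)%N]/5%N in E3.
pose e0 := (f 0 + f 3) / 2 - 1; pose h0 := (f 0 - f 3) / 2.
pose e1 := (f 4 + f 1) / 2 - 1; pose h1 := (f 4 - f 1) / 2.
pose e2 := (f 2 + f 5) / 2 - 1; pose h2 := (f 2 - f 5) / 2.
have f6 : f 5 = 6 - f 0 - f 1 - f 2 - f 3 - f 4.
  by move: f1; rewrite /mean !big_ord_recr big_ord0 /=; lra.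
have [g0 g3] : f 0 - 1 = e0 + h0 /\ f 3 - 1 = e0 - h0 by rewrite /e0 /h0; split; field.
have [g4 g1] : f 4 - 1 = e1 + h1 /\ f 1 - 1 = e1 - h1 by rewrite /e1 /h1; split; field.
have [g2 g5] : f 2 - 1 = e2 + h2 /\ f 5 - 1 = e2 - h2 by rewrite /e2 /h2; split; field.
have e_0 : e0 + e1 + e2 = 0 by rewrite /e0 /e1 /e2 f6; field.
have [p0 p1 p2] : [/\ 0 <= f 0, 0 <= f 1 & 0 <= f 2] by [].
have [p3 p4 p5] : [/\ 0 <= f 3, 0 <= f 4 & 0 <= f 5] by [].
have q0 : `|h0| <= 1 + e0 by rewrite ler_norml; lra.
have q1 : `|h1| <= 1 + e1 by rewrite ler_norml; lra.
have q2 : `|h2| <= 1 + e2 by rewrite ler_norml; lra.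
have ME m : mean 6 (fun x => (f x - 1) ^+ m) =
    ((e0 + h0) ^+ m + (e0 - h0) ^+ m + (e1 + h1) ^+ m
    + (e1 - h1) ^+ m + (e2 + h2) ^+ m + (e2 - h2) ^+ m) / 6.
  by rewrite /mean !big_ord_recr big_ord0 /= g0 g1 g2 g3 g4 g5; field.
have := entropy_le_moments (isT : (0 < 6)%N) f0 f1 erefl.
have := Z6_moment_bound e_0 q0 q1 q2 ME erefl.
have -> : 3 * (6%:R + 1) = 21 :> R by ring.
have -> : s 3 = ((h0 + h1 + h2) / 3) ^+ 2 by rewrite F3 /h0 /h1 /h2; field.
have s24 : s 2 + s 4 = (e0 ^+ 2 + e1 ^+ 2 + e2 ^+ 2) / 3.
  move: E3; rewrite F0 /e0 /e1 /e2 f6; lra.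
have s15 : s 1 + s 5 = (h0 ^+ 2 + h1 ^+ 2 + h2 ^+ 2) / 3 - s 3.
  move: E E3; rewrite F0 /h0 /h1 /h2; lra.
rewrite -[minn 0 _]/0%N -[minn 1 _]/1%N -[minn 2 _]/2%N -[minn 3 _]/3%N.
rewrite -[minn 4 _]/2%N -[minn 5 _]/1%N.
move: s15; rewrite (_ : s 3 = ((h0 + h1 + h2) / 3) ^+ 2); last by rewrite F3 /h0 /h1 /h2; field.
lra.
Qed.
End Doubling.

(** * From Z_n to Z_2n *)

Section DoublingStep.
Context {R : realType}.
Implicit Types (f g : nat -> R).

Lemma mean_parity n g : (0 < n)%N ->
  mean (2 * n) g = (mean n (fun x => g (2 * x)%N) + mean n (fun x => g (2 * x).+1)) / 2.
Proof.
move=> n0; have nR : n%:R != 0 :> R by rewrite pnatr_eq0 -lt0n.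
by rewrite /mean sum_parity big_split /= natrM; field.
Qed.

(** The chain rule for the entropy, followed by [two_point] for the entropy of the pair of
    squared norms. *)
Lemma entropy_parity n f : (0 < n)%N ->
  entropy (2 * n) f <= (entropy n (fun x => f (2 * x)%N) + entropy n (fun x => f (2 * x).+1)) / 2
   + (Num.sqrt (mean n (fun x => f (2 * x)%N ^+ 2)) -
      Num.sqrt (mean n (fun x => f (2 * x).+1 ^+ 2))) ^+ 2 / 2.
Proof.
move=> n0; rewrite /entropy !mean_parity//.
set S := mean n (fun x => f (2 * x)%N ^+ 2); set T := mean n (fun x => f (2 * x).+1 ^+ 2).
have S0 : 0 <= S by apply: mean_ge0 => x _; exact: sqr_ge0.
have T0 : 0 <= T by apply: mean_ge0 => x _; exact: sqr_ge0.
by have := two_point (sqrtr_ge0 S) (sqrtr_ge0 T); rewrite !sqr_sqrtr//; lra.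
Qed.

(** The triangle inequality (|u + v| - |u - v|)^2 <= 4 |v|^2, expanded. *)
Lemma sqrt_sqnorm_lipschitz (u v : R[i]) :
  sqnorm (u + v) + sqnorm (u - v) - 4 * sqnorm v <= 2 * (Num.sqrt (sqnorm (u + v)) * Num.sqrt (sqnorm (u - v))).
Proof.
rewrite -sqrtrM ?sqnorm_ge0//.
have -> : sqnorm (u + v) + sqnorm (u - v) - 4 * sqnorm v = 2 * (sqnorm u - sqnorm v).
  by have := sqnormDB u v; lra.
rewrite ler_pM2l// (le_trans (ler_norm _))// -sqrtr_sqr ler_sqrt ?mulr_ge0 ?sqnorm_ge0//.
case: u v => [a b] [c d]; rewrite /sqnorm /=.
by have := sqr_ge0 (a * d - b * c); lra.
Qed.

Lemma cauchy_schwarz n (P : pred 'I_n) (u v : 'I_n -> R) :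
  (forall i, 0 <= u i) -> (forall i, 0 <= v i) ->
  \sum_(i | P i) Num.sqrt (u i) * Num.sqrt (v i) <=
  Num.sqrt (\sum_(i | P i) u i) * Num.sqrt (\sum_(i | P i) v i).
Proof.
move=> u0 v0; set U := \sum_(i | P i) u i; set V := \sum_(i | P i) v i.
have U0 : 0 <= U by apply: sumr_ge0.
have V0 : 0 <= V by apply: sumr_ge0.
have H : 0 <= \sum_(i | P i) (Num.sqrt (u i) * Num.sqrt V - Num.sqrt (v i) * Num.sqrt U) ^+ 2.
  by apply: sumr_ge0 => i _; exact: sqr_ge0.
set W := \sum_(i | P i) _; set a := Num.sqrt U; set b := Num.sqrt V.
have a0 : 0 <= a := sqrtr_ge0 _; have b0 : 0 <= b := sqrtr_ge0 _.
have HE : \sum_(i | P i) (Num.sqrt (u i) * b - Num.sqrt (v i) * a) ^+ 2 = 2 * (a * b) * (a * b - W).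
  transitivity (\sum_(i | P i) (V * u i + U * v i - 2 * (a * b) * (Num.sqrt (u i) * Num.sqrt (v i)))).
    apply: eq_bigr => i _; rewrite -[V](sqr_sqrtr V0) -[U](sqr_sqrtr U0) -/a -/b.
    by rewrite -[in RHS](sqr_sqrtr (u0 i)) -[in RHS](sqr_sqrtr (v0 i)) !sqrtr_sqr !ger0_norm ?sqrtr_ge0//; ring.
  rewrite sumrB big_split /= -!mulr_sumr -/U -/V -/W.
  by rewrite -[in LHS](sqr_sqrtr V0) -[in LHS](sqr_sqrtr U0) -/a -/b; ring.
rewrite HE in H.
have z (t : 'I_n -> R) : (forall i, 0 <= t i) -> \sum_(i | P i) t i = 0 -> forall i, P i -> t i = 0.
  by move=> t0 /psumr_eq0P; apply.
have [aE|an] := eqVneq a 0.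
  have U00 : U = 0 by rewrite -(sqr_sqrtr U0) -/a aE expr0n.
  by rewrite aE mul0r /W big1// => i Pi; rewrite (z u)// sqrtr0 mul0r.
have [bE|bn] := eqVneq b 0.
  have V00 : V = 0 by rewrite -(sqr_sqrtr V0) -/b bE expr0n.
  by rewrite bE mulr0 /W big1// => i Pi; rewrite (z v)// sqrtr0 mulr0.
by move: H; rewrite pmulr_rge0 ?subr_ge0// !mulr_gt0// lt_neqAle eq_sym ?an ?bn ?a0 ?b0.
Qed.

(** X and Y are the squared coefficients at the frequency where the energy gains nothing, and
    Ma, Mb the norms of the other parts. As X <= Ma^2, adding X moves the norm from Ma
    by at most (sqrt 2 - 1) sqrt X, and (sqrt 2 - 1)^2 < 1/5. *)
Lemma norm_gap (X Y Ma Mb G : R) : 0 <= Ma -> 0 <= Mb -> 0 <= X <= Ma ^+ 2 -> 0 <= Y <= Mb ^+ 2 ->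
  (Ma - Mb) ^+ 2 <= G ->
  (Num.sqrt (X + Ma ^+ 2) - Num.sqrt (Y + Mb ^+ 2)) ^+ 2 / 2 <= (X + Y) / 5 + G.
Proof.
have gap (x m : R) : 0 <= m -> 0 <= x <= m ^+ 2 ->
    0 <= Num.sqrt (x + m ^+ 2) - m /\ (Num.sqrt (x + m ^+ 2) - m) ^+ 2 <= x / 5.
  move=> m0 /andP[x0 xm]; have xm0 : 0 <= x + m ^+ 2 by rewrite addr_ge0 ?sqr_ge0.
  set d := Num.sqrt _ - m.
  have d0 : 0 <= d.
    by rewrite subr_ge0 -{1}(ger0_norm m0) -sqrtr_sqr ler_sqrt// lerDr.
  have xE : x = d ^+ 2 + 2 * d * m.
    have := sqr_sqrtr xm0; rewrite (_ : Num.sqrt _ = d + m); last by rewrite /d; ring.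
    lra.
  split=> //; have dm : 2 * d <= m by rewrite leNgt; apply/negP => md; nra.
  nra.
move=> Ma0 Mb0 X0 Y0 Gab.
wlog le : X Y Ma Mb Ma0 Mb0 X0 Y0 Gab / Num.sqrt (Y + Mb ^+ 2) <= Num.sqrt (X + Ma ^+ 2).
  move=> H; have [le|/ltW le] := leP (Num.sqrt (Y + Mb ^+ 2)) (Num.sqrt (X + Ma ^+ 2)); first exact: H.
  by rewrite -sqrrN opprB [X + Y]addrC; apply: H => //; rewrite -sqrrN opprB.
have [dX dX2] := gap _ _ Ma0 X0; have [dY _] := gap _ _ Mb0 Y0.
move: le dX dX2 dY; set A := Num.sqrt (X + _); set B := Num.sqrt (Y + _) => AB dX dX2 dY.
have Y00 : 0 <= Y by case/andP: Y0.
have le1 : (A - B) ^+ 2 <= (A - Ma + (Ma - Mb)) ^+ 2 by apply: lerXn2r; rewrite ?nnegrE; lra.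
have := sqr_ge0 (A - Ma - (Ma - Mb)).
lra.
Qed.

Lemma even_gap m j : j != m -> (2 <= (2 * m - 2 * j) + (2 * j - 2 * m))%N.
Proof. by move=> jm; lia. Qed.

(** The weight of the pair of frequencies j, j + n in twice the energy on Z_2n: the
    word length of j in Z_n for both, and twice |n - 2j| more for the one that is farther from 0. The
    weight |n - 2j| is a sum of two truncated differences. *)
Lemma doubled_word_length (s t : R) n j : (j < n)%N ->
  2 * ((minn j (2 * n - j))%:R * s + (minn (j + n) (2 * n - (j + n)))%:R * t) =
  (minn j (n - j))%:R * (2 * s + 2 * t)
  + 2 * (((n - 2 * j) + (2 * j - n))%:R * (if (2 * j <= n)%N then t else s)).
Proof.
move=> jn; rewrite (_ : minn j (2 * n - j) = j); last by lia.
rewrite (_ : minn (j + n) (2 * n - (j + n)) = n - j)%N; last by lia.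
case: ifP => jm.
  rewrite (_ : minn j (n - j) = j); last by lia.
  rewrite (_ : (n - 2 * j + (2 * j - n) = n - 2 * j)%N); last by lia.
  by rewrite !natrB ?natrM//; [ring|lia].
rewrite (_ : minn j (n - j) = n - j)%N; last by lia.
rewrite (_ : (n - 2 * j + (2 * j - n) = 2 * j - n)%N); last by lia.
by rewrite !natrB ?natrM; [ring|lia|lia].
Qed.

(** Besides j = n/2, all weights |n - 2j| are at least 2 since n is even, and the
    weight of j = 0 is n >= 4: half of it is left to diminish the energy of the frequency n
    of f. *)
Lemma log_sob_double m : (2 <= m)%N -> log_sob (2 * m) (5^-1 : R) -> log_sob (2 * (2 * m)) (5^-1 : R).
Proof.
move=> m2 IH f f0; set n := (2 * m)%N in IH *.
have n0 : (0 < n)%N by rewrite /n; clear -m2; lia.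
have n4 : (4 <= n)%N by rewrite /n; clear -m2; lia.
have m_n : (m < n)%N by rewrite /n; clear -m2; lia.
set F := fourier (2 * n) f.
pose a x := f (2 * x)%N; pose b x := f (2 * x).+1.
pose al j := sqnorm (fourier n a j); pose be j := sqnorm (fourier n b j).
have alE j : al j = sqnorm (F j + F (j + n)%N) by rewrite /al fourier_evens.
have beE j : be j = sqnorm (F j - F (j + n)%N) by rewrite /be fourier_odds// sqnormM sqnorm_expi mul1r.
(* the one of the coefficients j, j + n with the larger word length in Z_2n *)
pose ga (j : 'I_n) := if (2 * j <= n)%N then sqnorm (F (j + n)%N) else sqnorm (F j).
pose w (j : 'I_n) := ((n - 2 * j) + (2 * j - n))%N.
have ga0 j : 0 <= ga j by rewrite /ga; case: ifP => _; exact: sqnorm_ge0.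
have energy : 2 * \sum_(k < 2 * n) (minn k (2 * n - k))%:R * sqnorm (F k) =
    \sum_(j < n) ((minn j (n - j))%:R * (al j + be j) + 2 * ((w j)%:R * ga j)).
  rewrite (sum_double _ (fun k => (minn k (2 * n - k))%:R * sqnorm (F k))) mulr_sumr.
  apply: eq_bigr => j _; rewrite alE beE sqnormDB /ga /w.
  rewrite -(doubled_word_length _ _ (ltn_ord j)); ring.
pose mo := Ordinal m_n.
have o0 : Ordinal n0 != mo by rewrite -val_eqE /= eq_sym -lt0n; exact: ltnW.
pose Ma2 := \sum_(j < n | j != mo) al j; pose Mb2 := \sum_(j < n | j != mo) be j.
pose G := \sum_(j < n | j != mo) ga j.
have a2E : mean n (fun x => a x ^+ 2) = al m + Ma2.
  by rewrite -parseval_fourier (bigD1 mo).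
have b2E : mean n (fun x => b x ^+ 2) = be m + Mb2.
  by rewrite -parseval_fourier (bigD1 mo).
have al0 j : 0 <= al j := sqnorm_ge0 _; have be0 j : 0 <= be j := sqnorm_ge0 _.
have Ma0 : 0 <= Ma2 by apply: sumr_ge0.
have Mb0 : 0 <= Mb2 by apply: sumr_ge0.
(* at frequency m = n/2 the coefficient is bounded by the mean, which has frequency 0 != m *)
have lowmid g : (forall x, 0 <= g x) -> sqnorm (fourier n g m) <= \sum_(j < n | j != mo) sqnorm (fourier n g j).
  move=> g0; rewrite (bigD1 (Ordinal n0))//= fourier0 fourier_mid; last exact: ltnW.
  rewrite !sqnorm_real; apply: (@le_trans _ _ (mean n g ^+ 2)); last first.
    by rewrite lerDl; apply: sumr_ge0 => j _; exact: sqnorm_ge0.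
  rewrite -[leLHS]real_normK ?num_real// lerXn2r ?nnegrE ?mean_ge0//.
  rewrite ler_norml -meanN; apply/andP; split; apply: mean_le => x _.
    by rewrite -signr_odd; case: odd; rewrite ?expr0 ?expr1; have := g0 x; lra.
  by rewrite -signr_odd; case: odd; rewrite ?expr0 ?expr1; have := g0 x; lra.
have gap : (Num.sqrt Ma2 - Num.sqrt Mb2) ^+ 2 <= 4 * G.
  rewrite sqrrB !sqr_sqrtr//.
  have := @cauchy_schwarz n (fun j => j != mo) (fun j => al j) (fun j => be j) al0 be0.
  rewrite -/Ma2 -/Mb2 => CS.
  have : Ma2 + Mb2 - 4 * G <= 2 * \sum_(j < n | j != mo) Num.sqrt (al j) * Num.sqrt (be j).
    rewrite /Ma2 /Mb2 /G -big_split !mulr_sumr -sumrB; apply: ler_sum => j _ /=.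
    rewrite alE beE /ga; case: ifP => _; first exact: sqrt_sqnorm_lipschitz.
    have := sqrt_sqnorm_lipschitz (F (j + n)%N) (F j); rewrite [F (j + n)%N + _]addrC.
    by rewrite -[F (j + n)%N - _]opprB (_ : sqnorm (- _) = sqnorm (F j - F (j + n)%N))// /sqnorm; case: (F _ - _) => ? ? /=; ring.
  lra.
have Xa : 0 <= al m <= Num.sqrt Ma2 ^+ 2.
  by rewrite al0 sqr_sqrtr//; apply: lowmid => x; exact: f0.
have Yb : 0 <= be m <= Num.sqrt Mb2 ^+ 2.
  by rewrite be0 sqr_sqrtr//; apply: lowmid => x; exact: f0.
have NG := norm_gap (sqrtr_ge0 Ma2) (sqrtr_ge0 Mb2) Xa Yb gap.
rewrite !sqr_sqrtr// -a2E -b2E in NG.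
have EN := entropy_parity f n0.
have Ea := IH a (fun x => f0 _); have Eb := IH b (fun x => f0 _).
have n2 : n./2 = m by rewrite /n mul2n doubleK.
rewrite n2 -[sqnorm _]/(al m) in Ea; rewrite n2 -[sqnorm _]/(be m) in Eb.
have slack : 4 * G + 2 / 5 * sqnorm (F n) <= \sum_(j < n) 2 * ((w j)%:R * ga j).
  rewrite (bigD1 mo)//= /G (bigD1 (Ordinal n0))//= [in leRHS](bigD1 (Ordinal n0))//=.
  have -> : ga (Ordinal n0) = sqnorm (F n) by [].
  have w4 : 4%:R <= (w (Ordinal n0))%:R :> R by rewrite ler_nat /w /= subn0; exact: leq_trans n4 (leq_addr _ _).
  have Fn0 := sqnorm_ge0 (F n).
  have w4F := ler_wpM2r Fn0 w4.
  have : 0 <= 2 * ((w mo)%:R * ga mo) by rewrite !mulr_ge0.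
  set S1 := \sum_(i < n | _) _; set S2 := \sum_(i < n | _) _.
  have : 4 * S1 <= S2.
    rewrite /S1 /S2 mulr_sumr; apply: ler_sum => j /andP[jm _].
    have w2 : 2%:R <= (w j)%:R :> R.
      by rewrite ler_nat; exact: even_gap.
    by have := ler_wpM2r (ga0 j) w2; lra.
  lra.
have -> : (2 * n)./2 = n by rewrite mul2n doubleK.
rewrite -/F energy big_split /=.
have : \sum_(j < n) (minn j (n - j))%:R * (al j + be j) =
   \sum_(j < n) (minn j (n - j))%:R * al j + \sum_(j < n) (minn j (n - j))%:R * be j.
  by rewrite -big_split; apply: eq_bigr => j _ /=; ring.
lra.
Qed.
End DoublingStep.

(** * The inequality of Stroock and Varopoulos *)

Section RightDerivative.
Context {R : realType}.
Local Open Scope classical_set_scope.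
Local Open Scope ring_scope.

Lemma der_frequently_ge0 (f : R -> R) d : hasder f 0 d ->
  (forall e, 0 < e -> exists2 s, 0 < s < e & f 0 <= f s) -> 0 <= d.
Proof.
move=> [Df <-] f0; rewrite ['D_1 f 0]cvg_at_rightE//; apply/negP => /negP; rewrite -ltNge => dlt0.
have cv : (fun h : R => h^-1 *: ((f \o shift 0) (h *: 1) - f 0)) @ 0^'+ -->
    lim ((fun h : R => h^-1 *: ((f \o shift 0) (h *: 1) - f 0)) @ 0^'+).
  rewrite -(cvg_at_rightE (fun h : R => h^-1 *: ((f \o shift 0) _ - f 0)))//.
  apply: cvg_trans Df; apply: cvg_app.
  by move=> A [e egt0 Ae]; exists e => // x xe xgt0; apply: Ae => //; exact/lt0r_neq0.
have [e /= e0 He] := cvgr_lt _ cv _ dlt0.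
have [s /andP[s0 se] fs] := f0 e e0.
have := He s; rewrite /= sub0r normrN gtr0_norm// => /(_ se s0).
rewrite addr0 [_%:A]mulr1 => /lt_geF/negP; apply.
by apply: mulr_ge0; [rewrite invr_ge0 ltW|rewrite subr_ge0].
Qed.

Lemma der_right_ge0 (f : R -> R) d : hasder f 0 d -> (forall s, 0 < s -> f 0 <= f s) -> 0 <= d.
Proof.
move=> fd f0; apply: (der_frequently_ge0 fd) => e e0.
by exists (e / 2); [lra|apply: f0; rewrite divr_gt0].
Qed.
End RightDerivative.

Section SV.
Context {R : realType}.
Implicit Types (a b q s x y : R).

Lemma cosh_mono x y : `|x| <= y -> expR x + expR (- x) <= expR y + expR (- y).
Proof.
wlog x0 : x / 0 <= x.
  move=> H; have [x0|/ltW x0] := leP 0 x; first exact: H.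
  by rewrite -normrN => xy; rewrite addrC -{2}[x]opprK; apply: H; rewrite ?oppr_ge0.
rewrite ger0_norm// => xy.
have -> : expR y + expR (- y) = expR x + expR (- x) + (expR (y - x) - 1) * (expR x - expR (- y)).
  rewrite mulrBl mul1r !mulrBr -!expRD.
  have -> : y - x + x = y by ring.
  have -> : y - x - y = - x by ring.
  by ring.
by rewrite lerDl mulr_ge0// subr_ge0; [rewrite -expR0|]; rewrite ler_expR; lra.
Qed.

(** That (cosh y - 1) / y^2 increases with |y|, at |q - 2| s <= q s. The second derivative in s
    of the difference is a multiple of cosh (q s) - cosh ((q - 2) s). *)
Lemma cosh_quotient q s : 1 < q -> 0 <= s ->
  q ^+ 2 * (expR ((q - 2) * s) + expR (- ((q - 2) * s)) - 2) <=
  (q - 2) ^+ 2 * (expR (q * s) + expR (- (q * s)) - 2).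
Proof.
move=> q1 s0.
pose c k x : R := expR (k * x) + expR (- (k * x)).
pose d k x : R := k * (expR (k * x) - expR (- (k * x))).
have dc k x : hasder (c k) x (d k x).
  by rewrite /c; apply: der_eq; [der|rewrite /d; ring].
have dd k x : hasder (d k) x (k ^+ 2 * c k x).
  by rewrite /d; apply: der_eq; [der|rewrite /c; ring].
pose G x := (q - 2) ^+ 2 * (c q x - 2) - q ^+ 2 * (c (q - 2) x - 2).
pose G1 x := (q - 2) ^+ 2 * d q x - q ^+ 2 * d (q - 2) x.
pose G2 x := (q - 2) ^+ 2 * q ^+ 2 * (c q x - c (q - 2) x).
have dG x : hasder G x (G1 x).
  have d1 := dc q x; have d2 := dc (q - 2) x.
  by rewrite /G; apply: der_eq; [der|rewrite /G1; ring].
have dG1 x : hasder G1 x (G2 x).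
  have d1 := dd q x; have d2 := dd (q - 2) x.
  by rewrite /G1; apply: der_eq; [der|rewrite /G2; ring].
have G10 : G1 0 = 0 by rewrite /G1 /d !mulr0 oppr0; ring.
have G00 : G 0 = 0 by rewrite /G /c !mulr0 oppr0 !expR0; ring.
have G1ge x : 0 <= x -> 0 <= G1 x.
  move=> x0; rewrite -G10; apply: (@der_ge0_le _ G1 G2 _ _ x0) => y; first by move=> _; exact: dG1.
  move=> /andP[y0 _]; rewrite /G2; apply: mulr_ge0; first by apply: mulr_ge0; exact: sqr_ge0.
  rewrite subr_ge0.
  apply: cosh_mono; rewrite normrM (ger0_norm (ltW y0)) ler_pM2r//.
  by rewrite ler_norml; lra.
have : 0 <= G s.
  rewrite -G00; apply: (@der_ge0_le _ G G1 _ _ s0) => y; first by move=> _; exact: dG.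
  by move=> /andP[y0 _]; apply: G1ge; exact: ltW.
by rewrite /G /c subr_ge0.
Qed.

(** With x = m + s and y = m - s, both sides carry the factor e^(q m), and the remaining
    factors are linear in cosh (q s) and cosh ((q - 2) s): this is [cosh_quotient]. *)
Lemma stroock_varopoulos q x y : 1 < q ->
  (expR (q / 2 * x) - expR (q / 2 * y)) ^+ 2 <=
  q ^+ 2 / (4 * (q - 1)) * ((expR x - expR y) * (expR ((q - 1) * x) - expR ((q - 1) * y))).
Proof.
move=> q1; wlog xy : x y / y <= x.
  move=> H; have [/H//|/ltW/H] := leP y x.
  rewrite -sqrrN opprB => /le_trans; apply; apply: eqle; ring.
pose m := (x + y) / 2; pose s := (x - y) / 2.
have s0 : 0 <= s by rewrite /s; lra.
have -> : x = m + s by rewrite /m /s; field.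
have -> : y = m - s by rewrite /m /s; field.
have k0 : 0 < 4 * (q - 1) by lra.
rewrite [leRHS]mulrAC ler_pdivlMr//.
have -> : (expR (q / 2 * (m + s)) - expR (q / 2 * (m - s))) ^+ 2 =
   expR (q * m) * (expR (q * s) + expR (- (q * s)) - 2).
  have -> : q / 2 * (m + s) = q / 2 * m + q / 2 * s by ring.
  have -> : q / 2 * (m - s) = q / 2 * m - q / 2 * s by ring.
  have -> : q * m = q / 2 * m + q / 2 * m by field.
  have -> : q * s = q / 2 * s + q / 2 * s by field.
  rewrite opprD !expRD; set u := expR _; set v := expR (q / 2 * s); set w := expR (- _).
  have vw : v * w = 1 by rewrite /v /w -expRD subrr expR0.
  transitivity (u * u * (v * v + w * w - 2 * (v * w))); first by ring.
  by rewrite vw mulr1.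
have -> : (expR (m + s) - expR (m - s)) * (expR ((q - 1) * (m + s)) - expR ((q - 1) * (m - s))) =
   expR (q * m) * (expR (q * s) + expR (- (q * s)) - (expR ((q - 2) * s) + expR (- ((q - 2) * s)))).
  have prod (a b c d : R) : (expR a - expR b) * (expR c - expR d) =
      expR (a + c) + expR (b + d) - (expR (a + d) + expR (b + c)) by rewrite !expRD; ring.
  rewrite prod.
  have -> : m + s + (q - 1) * (m + s) = q * m + q * s by ring.
  have -> : m - s + (q - 1) * (m - s) = q * m - q * s by ring.
  have -> : m + s + (q - 1) * (m - s) = q * m + - ((q - 2) * s) by ring.
  have -> : m - s + (q - 1) * (m + s) = q * m - - ((q - 2) * s) by ring.
  by rewrite !expRD opprK; ring.
have e0 := expR_gt0 (q * m).
rewrite -[leLHS]mulrA [leRHS]mulrCA ler_pM2l//.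
have := cosh_quotient q1 s0; lra.
Qed.
End SV.

(** * The kernel of the semigroup and its jump rates *)

Section Kernel.
Context {R : realType}.
Local Arguments conjc : simpl never.
Implicit Types (z w : R[i]) (r t : R).

(** Both halves of the sum are geometric, in r z and in r w with w = 1/z; they combine because
    w^m = z^m. *)
Lemma kernel_closed_form (C : comRingType) m (r z w : C) : z * w = 1 -> z ^+ (2 * m) = 1 ->
  (1 - r * z) * (1 - r * w) * \sum_(k < 2 * m) r ^+ minn k (2 * m - k) * z ^+ k =
  (1 - r ^+ 2) * (1 - r ^+ m * z ^+ m).
Proof.
move=> zw z1.
have zmw : w ^+ m = z ^+ m.
  by rewrite -[LHS]mul1r -z1 mul2n -addnn exprD -mulrA -exprMn zw expr1n mulr1.
rewrite (sum_double _ (fun k => r ^+ minn k (2 * m - k) * z ^+ k)) big_split /=.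
have -> : \sum_(i < m) r ^+ minn i (2 * m - i) * z ^+ i = \sum_(i < m) (r * z) ^+ i.
  apply: eq_bigr => i _; rewrite exprMn (_ : minn i _ = i)//.
  by have := ltn_ord i; lia.
have -> : \sum_(i < m) r ^+ minn (i + m) (2 * m - (i + m)) * z ^+ (i + m) =
    r * w * \sum_(i < m) (r * w) ^+ i.
  rewrite (reindex_inj rev_ord_inj) /= mulr_sumr; apply: eq_bigr => i _.
  have im := ltn_ord i; rewrite (_ : minn _ _ = i.+1); last by lia.
  rewrite -exprS exprMn; congr (_ * _).
  rewrite -[RHS]mul1r -z1 (_ : 2 * m = m - i.+1 + m + i.+1)%N; last by lia.
  by rewrite [in RHS]exprD -mulrA -exprMn zw expr1n mulr1.
have g (x : C) : (1 - x) * \sum_(i < m) x ^+ i = 1 - x ^+ m.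
  by rewrite -opprB -[RHS]opprB subrX1 mulNr.
rewrite mulrDr.
transitivity ((1 - r * w) * ((1 - r * z) * \sum_(i < m) (r * z) ^+ i)
  + (1 - r * z) * (r * w) * ((1 - r * w) * \sum_(i < m) (r * w) ^+ i)); first by ring.
rewrite !g !exprMn zmw.
have -> : (1 - r * z) * (r * w) = r * w - r ^+ 2 * (z * w) by ring.
rewrite zw.
by ring.
Qed.

Lemma kernel_gt0 m (r : R) z : (0 < m)%N -> 0 <= r < 1 -> z * z^*%C = 1 -> z ^+ (2 * m) = 1 ->
  0 < \sum_(k < 2 * m) (r ^+ minn k (2 * m - k))%:C%C * z ^+ k.
Proof.
move=> m0 /andP[r0 r1] zz z1.
have K := kernel_closed_form r%:C%C zz z1.
have rm : r ^+ m < 1 by rewrite exprn_ilt1// -lt0n.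
have zm : z ^+ m = 1 \/ z ^+ m = -1.
  have : (z ^+ m) ^+ 2 == 1 by rewrite -exprM mulnC z1.
  by rewrite sqrf_eq1 => /orP[]/eqP; [left|right].
have rhs : 0 < (1 - r%:C%C ^+ 2) * (1 - r%:C%C ^+ m * z ^+ m) :> R[i].
  have rr : 0 < 1 - r%:C%C ^+ 2 :> R[i].
    by rewrite subr_gt0 -rmorphXn -[1]/(1%:C%C) ltcR exprn_ilt1//.
  apply: mulr_gt0 => //; case: zm => ->.
    by rewrite mulr1 subr_gt0 -rmorphXn -[1]/(1%:C%C) ltcR.
  by rewrite mulrN1 opprK ltr_pwDl// exprn_ge0// ler0c.
under eq_bigr do rewrite rmorphXn.
move: rhs; rewrite -K.
have -> : (1 - r%:C%C * z) * (1 - r%:C%C * z^*%C) = (1 - r%:C%C * z) * (1 - r%:C%C * z)^*%C.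
  by rewrite rmorphB rmorph1 rmorphM /= conjc_real.
move=> H; have p0 := mulcJ_ge0 (1 - r%:C%C * z).
have [pE|pn] := eqVneq ((1 - r%:C%C * z) * (1 - r%:C%C * z)^*%C) 0.
  by move: H; rewrite pE mul0r ltxx.
by rewrite pmulr_rgt0// lt_neqAle eq_sym pn p0 in H.
Qed.
End Kernel.

Section Jump.
Context {R : realType} (n : nat).
Local Arguments conjc : simpl never.
Implicit Types (u v : 'I_n -> R) (x y k : 'I_n) (t : R).

(** The root of unity whose powers are the products of characters at x and y. *)
Definition rot x y : R[i] := expi (2 * pi * (x%:R - y%:R) / n%:R).

Lemma ord_natr_neq0 x : n%:R != 0 :> R.
Proof. by rewrite pnatr_eq0 -lt0n (leq_ltn_trans _ (ltn_ord x)). Qed.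

Lemma chi_rot k x y : chi R k x * (chi R k y)^*%C = rot x y ^+ k.
Proof.
rewrite /chi -expiN -expiD /rot -expiMn; congr expi.
by field; exact: ord_natr_neq0 x.
Qed.

Lemma rot_expn x y : rot x y ^+ n = 1.
Proof.
have nR := ord_natr_neq0 x; rewrite /rot -expiMn divfK// mulrBr expiD expiN !expi_2pi.
by rewrite conjc1 mulr1.
Qed.

Lemma rot_conj x y : rot x y * (rot x y)^*%C = 1.
Proof. by rewrite /rot -expiN -expiD subrr expi0. Qed.

Lemma rotC x y : rot y x = (rot x y)^*%C.
Proof. by rewrite /rot -expiN; congr expi; ring. Qed.

Lemma conjM (z w : R[i]) : (z * w)^*%C = z^*%C * w^*%C.
Proof. exact: rmorphM. Qed.

Lemma conj_sum (I : Type) (r : seq I) (P : pred I) (F : I -> R[i]) :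
  (\sum_(i <- r | P i) F i)^*%C = \sum_(i <- r | P i) (F i)^*%C.
Proof. exact: rmorph_sum. Qed.

Lemma Re_conj (z : R[i]) : complex.Re z^*%C = complex.Re z.
Proof. by case: z. Qed.

Lemma ReM_real (a : R) (z : R[i]) : complex.Re (a%:C%C * z) = a * complex.Re z.
Proof. by case: z => b c /=; ring. Qed.

Lemma Re_rotC k x y : complex.Re (rot y x ^+ k) = complex.Re (rot x y ^+ k).
Proof. by rewrite rotC -rmorphXn Re_conj. Qed.

Lemma expR_psi t k : expR (- t * (psi k)%:R) = expR (- t) ^+ psi k.
Proof. exact: expRM_natr. Qed.

Definition pkernel t x y : R[i] := n%:R^-1 * \sum_(k < n) (expR (- t) ^+ psi k)%:C%C * rot x y ^+ k.

Lemma poisson_pkernel t (f : 'I_n -> R[i]) x : poisson t f x = \sum_y pkernel t x y * f y.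
Proof.
rewrite /poisson /fcoef.
under eq_bigr => k _.
  rewrite mulrAC mulrCA mulr_sumr mulr_sumr; over.
rewrite exchange_big; apply: eq_bigr => y _; rewrite /pkernel -mulrA mulr_suml mulr_sumr.
apply: eq_bigr => k _; rewrite expR_psi -chi_rot; ring.
Qed.

Lemma pkernel_gt0 t x y : ~~ odd n -> 0 < t -> 0 < pkernel t x y.
Proof.
move=> en t0; have n0 : (0 < n)%N := leq_ltn_trans (leq0n _) (ltn_ord x).
have nE : n = (2 * n./2)%N by rewrite mul2n -[LHS]odd_double_half (negPf en).
have m0 : (0 < n./2)%N by lia.
rewrite /pkernel mulr_gt0 ?invr_gt0 ?ltr0n//.
have r01 : 0 <= expR (- t) < 1 by rewrite expR_ge0 expR_lt1 oppr_lt0.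
have := kernel_gt0 m0 r01 (rot_conj x y).
by rewrite -nE rot_expn => /(_ erefl).
Qed.

(** The rate of the jump from x to y for the generator of the semigroup. *)
Definition rate x y : R := - (n%:R^-1 * \sum_(k < n) (psi k)%:R * complex.Re (rot x y ^+ k)).

Lemma sum_Re_rot x y : x != y -> \sum_(k < n) complex.Re (rot x y ^+ k) = 0.
Proof.
move=> xy; have := chi_ortho R x y; rewrite (negPf xy) mul0r => /(congr1 (@complex.Re R)).
rewrite Re_sum => H; rewrite -[RHS]H; apply: eq_bigr => k _.
by rewrite -chi_rot (chiC _ k x) (chiC _ k y).
Qed.

Lemma rateC x y : rate x y = rate y x.
Proof. by congr (- (_ * _)); apply: eq_bigr => k _; rewrite Re_rotC. Qed.

(** The kernel vanishes off the diagonal at t = 0 and is positive for t > 0, and the rate is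
    its derivative at 0. *)
Lemma rate_ge0 x y : ~~ odd n -> x != y -> 0 <= rate x y.
Proof.
move=> en xy; have n0 : (0 < n)%N := leq_ltn_trans (leq0n _) (ltn_ord x).
pose h t := n%:R^-1 * \sum_(k < n) expR (- t * (psi k)%:R) * complex.Re (rot x y ^+ k) : R.
have hE t : h t = complex.Re (pkernel t x y).
  rewrite /pkernel -natC -fmorphV ReM_real Re_sum; congr (_ * _).
  by apply: eq_bigr => k _; rewrite ReM_real expR_psi.
apply: (@der_right_ge0 _ h).
  rewrite /h; apply: der_eq; first by der.
  rewrite /rate [X in _ + X]mulr0 addr0 -mulrN -sumrN; congr (_ * _); apply: eq_bigr => k _.
  by rewrite oppr0 mul0r expR0; ring.
move=> t t0; rewrite {1}/h (eq_bigr (fun k => complex.Re (rot x y ^+ k))); last first.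
  by move=> k _; rewrite oppr0 mul0r expR0 mul1r.
rewrite sum_Re_rot// mulr0 hE.
by have := pkernel_gt0 x y en t0; rewrite ltcE => /andP[_ /ltW].
Qed.

Definition dirichlet u v : R := \sum_(k < n) (psi k)%:R *
  complex.Re (fcoef (fun x => (u x)%:C%C) k * (fcoef (fun x => (v x)%:C%C) k)^*%C).

Lemma dirichlet_rate u v : dirichlet u v = - (n%:R^-1 * \sum_x \sum_y rate x y * (u x * v y)).
Proof.
have E k : complex.Re (fcoef (fun x => (u x)%:C%C) k * (fcoef (fun x => (v x)%:C%C) k)^*%C)
   = n%:R^-1 * (n%:R^-1 * \sum_x \sum_y (u x * v y) * complex.Re (rot x y ^+ k)).
  rewrite /fcoef conjM conjc_inv conjc_nat conj_sum mulrACA -mulrA.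
  rewrite -natC -fmorphV !ReM_real; do 2 congr (_ * _).
  rewrite mulr_suml Re_sum; apply: eq_bigr => x _.
  rewrite mulr_sumr Re_sum; apply: eq_bigr => y _.
  rewrite conjM conjcK conjc_real mulrACA -rmorphM ReM_real; congr (_ * _).
  by rewrite -Re_conj conjM conjcK chi_rot.
rewrite /dirichlet; under eq_bigr => k _ do rewrite E mulrCA.
rewrite -mulr_sumr -mulrN; congr (_ * _); rewrite -sumrN.
under eq_bigr => k _ do rewrite mulr_sumr mulr_sumr.
rewrite exchange_big /=; apply: eq_bigr => x _.
rewrite -sumrN.
under eq_bigr => k _ do rewrite mulr_sumr mulr_sumr.
rewrite exchange_big /=; apply: eq_bigr => y _.
rewrite /rate mulNr opprK -[RHS]mulrA mulr_suml mulr_sumr; apply: eq_bigr => k _; ring.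
Qed.

Lemma sum_rate x : \sum_y rate x y = 0.
Proof.
rewrite sumrN -mulr_sumr exchange_big big1 ?mulr0 ?oppr0// => k _.
rewrite -mulr_sumr; have [k0|k0] := eqVneq (k : nat) 0%N.
  by rewrite /psi k0 min0n mul0r.
have n0 : (0 < n)%N := leq_ltn_trans (leq0n _) (ltn_ord x).
have := chi_ortho R k (Ordinal n0); rewrite -val_eqE /= (negPf k0) mul0r => H.
have {}H : \sum_y chi R k y = 0.
  rewrite -[RHS]H; apply: eq_bigr => y _.
  by rewrite (_ : chi R (Ordinal n0) y = 1) ?conjc1 ?mulr1// /chi mulr0 !mul0r expi0.
rewrite (eq_bigr (fun y => complex.Re ((chi R k x)^*%C * chi R k y))); last first.
  by move=> y _; rewrite -chi_rot -Re_conj conjM conjcK.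
by rewrite -Re_sum -mulr_sumr H mulr0 /= mulr0.
Qed.

Lemma dirichlet_jump u v : dirichlet u v =
  (2 * n%:R)^-1 * \sum_x \sum_y rate x y * ((u x - u y) * (v x - v y)).
Proof.
rewrite dirichlet_rate.
have r0 (w : 'I_n -> R) : \sum_x \sum_y rate x y * w x = 0.
  by rewrite big1// => x _; rewrite -mulr_suml sum_rate mul0r.
have r1 (w : 'I_n -> R) : \sum_x \sum_y rate x y * w y = 0.
  rewrite exchange_big big1//= => y _.
  rewrite -mulr_suml (_ : \sum_x rate x y = 0) ?mul0r//.
  by rewrite -[RHS](sum_rate y); apply: eq_bigr => x _; exact: rateC.
have sw : \sum_x \sum_y rate x y * (u y * v x) = \sum_x \sum_y rate x y * (u x * v y).
  by rewrite exchange_big; do 2 apply: eq_bigr => ? _; rewrite rateC.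
transitivity ((2 * n%:R)^-1 * (\sum_x \sum_y rate x y * (u x * v x) +
   \sum_x \sum_y rate x y * (u y * v y) - \sum_x \sum_y rate x y * (u x * v y)
   - \sum_x \sum_y rate x y * (u y * v x))).
  rewrite (r0 (fun x => u x * v x)) (r1 (fun x => u x * v x)) sw invfM; lra.
congr (_ * _); rewrite -big_split -!sumrB; apply: eq_bigr => x _ /=.
by rewrite -big_split -!sumrB; apply: eq_bigr => y _ /=; ring.
Qed.
End Jump.

(** * From entropy to norms *)

Section Gross.
Context {R : realType} (n : nat).
Implicit Types (u : 'I_n -> R) (q s : R).

Definition avg (g : 'I_n -> R) : R := n%:R^-1 * \sum_x g x.

(** The derivative of ln |U s|_{Q s} has the sign of Q' Ent(U^Q) + Q^2 E(U^(Q-1) U'). By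
    hypothesis Ent(U^Q) <= - Q^2 / (2 (Q - 1)) E(U^(Q-1) U'), and Q' = 2 l (Q - 1), which leaves
    (1 - l) Q^2 E(U^(Q-1) U') <= 0. *)
Lemma lognorm_nonincreasing (U dU : 'I_n -> R -> R) (p l T : R) : (0 < n)%N ->
  1 < p -> 0 <= l <= 1 -> 0 <= T ->
  (forall x s, 0 <= s -> 0 < U x s) -> (forall x s, hasder (U x) s (dU x s)) ->
  (forall s q, 0 <= s -> 1 < q ->
     avg (fun x => expR (q * ln (U x s)) * (q * ln (U x s)))
     - avg (fun x => expR (q * ln (U x s))) * ln (avg (fun x => expR (q * ln (U x s))))
     <= - (q ^+ 2 / (2 * (q - 1)) * avg (fun x => expR ((q - 1) * ln (U x s)) * dU x s))) ->
  (forall s q, 0 <= s -> 1 < q -> avg (fun x => expR ((q - 1) * ln (U x s)) * dU x s) <= 0) ->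
  forall Q, (forall s, Q s = 1 + (p - 1) * expR (2 * l * s)) ->
  ln (avg (fun x => expR (Q T * ln (U x T)))) / Q T <=
  ln (avg (fun x => expR (Q 0 * ln (U x 0)))) / Q 0.
Proof.
move=> n0 p1 /andP[l0 l1] T0 U0 dUE LSI dis Q QE.
have Q1 s : 1 < Q s by rewrite QE ltrDl mulr_gt0 ?expR_gt0// subr_gt0.
have dQ s : hasder Q s (2 * l * (Q s - 1)).
  rewrite QE (_ : Q = fun s => 1 + (p - 1) * expR (2 * l * s)); last by apply/funext.
  by apply: der_eq; [der|rewrite /=; ring].
pose M s := avg (fun x => expR (Q s * ln (U x s))).
pose I s := avg (fun x => expR ((Q s - 1) * ln (U x s)) * dU x s).
pose L s := avg (fun x => expR (Q s * ln (U x s)) * (Q s * ln (U x s))).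
pose dM s := 2 * l * (Q s - 1) / Q s * L s + Q s * I s.
have M0 s : 0 < M s.
  rewrite /M /avg mulr_gt0 ?invr_gt0 ?ltr0n// (bigD1 (Ordinal n0))//= ltr_pwDl ?expR_gt0//.
  by apply: sumr_ge0 => x _; exact: expR_ge0.
have dME s : 0 <= s -> hasder M s (dM s).
  move=> s0; have dQs := dQ s; have Qn : Q s != 0 by rewrite gt_eqF//; have := Q1 s; lra.
  have dE x : hasder (fun s => expR (Q s * ln (U x s))) s
     (expR (Q s * ln (U x s)) * (Q s * ((U x s)^-1 * dU x s) + ln (U x s) * (2 * l * (Q s - 1)))).
    by have dUx := dUE x s; have := U0 x s s0 => Ux; der.
  rewrite /M /avg; apply: der_eq.
    by apply: der_mul; [exact: der_cst|apply: der_sum => x; exact: dE].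
  rewrite mulr0 addr0 /dM /L /I /avg mulrCA [Q s * _]mulrCA -mulrDr; congr (_ * _).
  rewrite !mulr_sumr -big_split; apply: eq_bigr => x _ /=.
  have Ux := U0 x s s0.
  have -> : expR ((Q s - 1) * ln (U x s)) = expR (Q s * ln (U x s)) / U x s.
    by rewrite mulrBl mul1r expRB lnK.
  by field; rewrite Qn gt_eqF.
pose Phi s := ln (M s) / Q s.
pose dPhi s := (2 * l * (Q s - 1) * (L s - M s * ln (M s)) + Q s ^+ 2 * I s) / (M s * Q s ^+ 2).
apply: (@der_le0_ge _ Phi dPhi _ _ T0) => s /andP[s0 _].
  have Qn : Q s != 0 by rewrite gt_eqF//; have := Q1 s; lra.
  have dMs := dME s s0; have dQs := dQ s; have Ms := M0 s.
  rewrite /Phi; apply: der_eq; first by der.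
  by rewrite /dPhi /dM; field; rewrite Qn gt_eqF.
have {}s0 := ltW s0; have Qs := Q1 s.
rewrite /dPhi; apply: mulr_le0_ge0; last first.
  by rewrite invr_ge0 mulr_ge0 ?sqr_ge0// ltW.
have H1 := LSI s (Q s) s0 Qs; have H2 := dis s (Q s) s0 Qs.
rewrite -/(M s) -/(L s) -/(I s) in H1 H2.
have k0 : 0 <= 2 * l * (Q s - 1) by rewrite !mulr_ge0// subr_ge0 ltW.
have := ler_wpM2l k0 H1.
have -> : 2 * l * (Q s - 1) * - (Q s ^+ 2 / (2 * (Q s - 1)) * I s) = - (l * Q s ^+ 2 * I s).
  by field; lra.
have : 0 <= (1 - l) * (Q s ^+ 2 * - I s).
  by rewrite mulr_ge0 ?subr_ge0// mulr_ge0 ?sqr_ge0// oppr_ge0.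
lra.
Qed.

End Gross.

Section LSI.
Context {R : realType} (n k : nat).
Context (k0 : (1 <= k)%N) (nE : n = (3 * 2 ^ k)%N \/ n = (2 ^ k)%N).

Lemma log_sob_weaken m (d : R) : 0 <= d -> log_sob m d -> log_sob m (0 : R).
Proof.
move=> d0 H f f0; apply: (le_trans (H f f0)).
by rewrite mulr0 mul0r subr0 lerBlDr lerDl !mulr_ge0// sqnorm_ge0.
Qed.

Lemma log_sob_all : log_sob n (0 : R).
Proof.
case: nE => ->.
  apply: (@log_sob_weaken _ 5^-1); first by rewrite invr_ge0.
  case: k k0 => // j _; elim: j => [|j IH]; first exact: log_sob_Z6.
  rewrite expnS mulnCA; rewrite expnS mulnCA in IH *.
  apply: log_sob_double IH.
  by have := expn_gt0 2 j; lia.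
case: k k0 => // -[_|j _]; first exact: log_sob_Z2.
apply: (@log_sob_weaken _ 5^-1); first by rewrite invr_ge0.
elim: j => [|j IH]; first exact: log_sob_Z4.
rewrite expnS; rewrite expnS in IH *; apply: log_sob_double IH.
by rewrite expnS; have := expn_gt0 2 j; lia.
Qed.

Lemma even_order : ~~ odd n.
Proof. by case: nE => ->; rewrite ?oddM oddX /=; case: k k0. Qed.

Lemma order_gt0 : (0 < n)%N.
Proof. by case: nE => ->; rewrite ?muln_gt0 ?expn_gt0. Qed.

Lemma log_sobolev (v : 'I_n -> R) : (forall x, 0 <= v x) ->
  avg (fun x => v x ^+ 2 * ln (v x ^+ 2)) - avg (fun x => v x ^+ 2) * ln (avg (fun x => v x ^+ 2))
  <= 2 * dirichlet v v.
Proof.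
move=> v0; pose f x := if insub x is Some i then v i else 0.
have fE (i : 'I_n) : f i = v i by rewrite /f valK.
have f0 x : 0 <= f x by rewrite /f; case: insub.
have := log_sob_all f0; rewrite /entropy /mean mulr0 mul0r subr0.
under eq_bigr do rewrite fE; under [in X in _ - X * _]eq_bigr do rewrite fE.
under [in X in _ - _ * X]eq_bigr do rewrite fE.
move/le_trans; apply; apply: eqle; congr (_ * _); apply: eq_bigr => i _.
rewrite sqnormE fourier_fcoef /psi (_ : (fun x : 'I_n => (f x)%:C%C) = fun x => (v x)%:C%C)//.
by apply/funext => x; rewrite fE.
Qed.

(** The logarithmic Sobolev inequality for u^(q/2); its energy is compared jump by jump with
    that of the pair u, u^(q-1). *)
Lemma log_sobolev_q (u : 'I_n -> R) q : (forall x, 0 < u x) -> 1 < q ->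
  avg (fun x => expR (q * ln (u x)) * (q * ln (u x)))
  - avg (fun x => expR (q * ln (u x))) * ln (avg (fun x => expR (q * ln (u x))))
  <= q ^+ 2 / (2 * (q - 1)) * dirichlet u (fun x => expR ((q - 1) * ln (u x))).
Proof.
move=> u0 q1; have e2 x : expR (q / 2 * ln (u x)) ^+ 2 = expR (q * ln (u x)).
  by rewrite -expRM_natr; congr expR; field.
have := @log_sobolev (fun x => expR (q / 2 * ln (u x))) (fun x => expR_ge0 _).
rewrite /avg.
under eq_bigr do rewrite e2 expRK; under [in X in _ - X * _]eq_bigr do rewrite e2.
under [in X in _ - _ * X]eq_bigr do rewrite e2.
move/le_trans; apply.
have q0 : 0 < q - 1 by rewrite subr_gt0.
have -> : q ^+ 2 / (2 * (q - 1)) = 2 * (q ^+ 2 / (4 * (q - 1))) by field; lra.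
rewrite -mulrA ler_pM2l// !dirichlet_jump mulrCA ler_wpM2l ?invr_ge0//.
rewrite mulr_sumr; apply: ler_sum => x _; rewrite mulr_sumr; apply: ler_sum => y _.
have [->|xy] := eqVneq x y; first by rewrite !subrr !mul0r !mulr0.
rewrite [leRHS]mulrCA ler_wpM2l ?rate_ge0 ?even_order//.
have := stroock_varopoulos (ln (u x)) (ln (u y)) q1.
by rewrite !lnK ?posrE// expr2.
Qed.

Lemma dirichlet_power_ge0 (u : 'I_n -> R) q : (forall x, 0 < u x) -> 1 < q ->
  0 <= dirichlet u (fun x => expR ((q - 1) * ln (u x))).
Proof.
move=> u0 q1; rewrite dirichlet_jump mulr_ge0 ?invr_ge0//.
apply: sumr_ge0 => x _; apply: sumr_ge0 => y _.
have [->|xy] := eqVneq x y; first by rewrite !subrr !mul0r !mulr0.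
rewrite mulr_ge0 ?rate_ge0 ?even_order//.
have := stroock_varopoulos (ln (u x)) (ln (u y)) q1.
rewrite !lnK ?posrE// => /(le_trans (sqr_ge0 _)); rewrite pmulr_rge0//.
by rewrite divr_gt0 ?exprn_gt0//; lra.
Qed.
End LSI.

(** * Sufficiency *)

Section Frequent.
Context {R : realType}.
Local Open Scope classical_set_scope.
Local Open Scope ring_scope.

Lemma powR_shift_cvg (a p : R) : 0 <= a -> 0 < p -> (a + e) `^ p @[e --> 0^'+] --> a `^ p.
Proof.
rewrite le_eqVlt => /orP[/eqP<-|a0] p0.
  rewrite powR0 ?gt_eqF//; under eq_cvg do rewrite add0r; exact: powR_cvg0.
apply: cvg_at_right_filter.
have c1 : (a + e) @[e --> (0 : R)] --> a + 0 by apply: cvgD; [exact: cvg_cst|exact: cvg_id].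
rewrite addr0 in c1.
have := der_continuous (is_derive1_powR p a0 : hasder _ _ _).
by move=> c2; exact: (cvg_comp _ _ c1 c2).
Qed.

(** Lets |f| + e tend to |f| at the level of p-th powers, where only the continuity of each
    summand is needed. *)
Lemma avg_shift_le n (g : 'I_n -> R) (p C : R) : 0 < p -> (forall x, 0 <= g x) ->
  (forall e, 0 < e -> C <= avg (fun x => (g x + e) `^ p)) -> C <= avg (fun x => g x `^ p).
Proof.
move=> p0 g0 H.
have cv : avg (fun x => (g x + e) `^ p) @[e --> 0^'+] --> avg (fun x => g x `^ p).
  rewrite /avg; apply: cvgM; first exact: cvg_cst.
  apply: cvg_big => [|x _]; [exact: add_continuous|exact: powR_shift_cvg].
apply: (cvgr_to_ge cv); near=> e; apply: H.
by near: e; exact: nbhs_right_gt.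
Unshelve. all: by end_near. Qed.
End Frequent.

Section Hyper.
Context {R : realType} (n : nat).
Local Arguments conjc : simpl never.
Implicit Types (u v : 'I_n -> R) (s t p q : R).

Lemma pnorm_avg p (f : 'I_n -> R[i]) : pnorm p f = avg (fun x => Normc.normc (f x) `^ p) `^ p^-1.
Proof. by []. Qed.

Lemma normc_ge0 (z : R[i]) : 0 <= Normc.normc z.
Proof. by case: z => a b; exact: sqrtr_ge0. Qed.

Lemma norm_normc (z : R[i]) : (Normc.normc z)%:C%C = `|z|.
Proof. by case: z. Qed.

Lemma avg_le (g h : 'I_n -> R) : (forall x, g x <= h x) -> avg g <= avg h.
Proof. by move=> gh; rewrite /avg ler_wpM2l ?invr_ge0//; apply: ler_sum => x _. Qed.

Lemma avg_ge0 (g : 'I_n -> R) : (forall x, 0 <= g x) -> 0 <= avg g.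
Proof. by move=> g0; rewrite /avg mulr_ge0 ?invr_ge0//; apply: sumr_ge0. Qed.

Lemma pnorm_le p (f g : 'I_n -> R[i]) : 0 <= p ->
  (forall x, Normc.normc (f x) <= Normc.normc (g x)) -> pnorm p f <= pnorm p g.
Proof.
move=> p0 fg; rewrite !pnorm_avg ge0_ler_powR ?invr_ge0 ?nnegrE//.
- by apply: avg_ge0 => x; exact: powR_ge0.
- by apply: avg_ge0 => x; exact: powR_ge0.
- by apply: avg_le => x; rewrite ge0_ler_powR// nnegrE normc_ge0.
Qed.

Lemma pnorm_pos p u : (0 < n)%N -> (forall x, 0 < u x) ->
  pnorm p (fun x => (u x)%:C%C) = expR (ln (avg (fun x => expR (p * ln (u x)))) / p).
Proof.
move=> n0 u0; rewrite pnorm_avg.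
have -> : avg (fun x => Normc.normc (u x)%:C%C `^ p) = avg (fun x => expR (p * ln (u x))).
  congr (_ * _); apply: eq_bigr => x _.
  by rewrite /= expr0n addr0 sqrtr_sqr gtr0_norm// /powR gt_eqF.
have A0 : 0 < avg (fun x => expR (p * ln (u x))).
  rewrite /avg mulr_gt0 ?invr_gt0 ?ltr0n// (bigD1 (Ordinal n0))//= ltr_pwDl ?expR_gt0//.
  by apply: sumr_ge0 => x _; exact: expR_ge0.
by rewrite /powR gt_eqF// mulrC.
Qed.

Lemma poisson0 (f : 'I_n -> R[i]) x : poisson 0 f x = f x.
Proof.
rewrite -[RHS]fcoef_inv; apply: eq_bigr => k _.
by rewrite oppr0 mul0r expR0 mul1r.
Qed.

Lemma fcoef_poisson t (f : 'I_n -> R[i]) k :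
  fcoef (poisson t f) k = (expR (- t * (psi k)%:R))%:C%C * fcoef f k.
Proof. exact: fcoef_trig. Qed.

Lemma pos_real (z : R[i]) : 0 < z -> z = (complex.Re z)%:C%C /\ 0 < complex.Re z.
Proof. by case: z => a b; rewrite ltcE /= => /andP[/eqP-> a0]. Qed.

Section positive.
Context (en : ~~ odd n) (u : 'I_n -> R) (u0 : forall x, 0 < u x).
Let uC := fun x => (u x)%:C%C.
Let U x s := complex.Re (poisson s uC x).
Let dU x s := \sum_(k < n) - (psi k)%:R * expR (- s * (psi k)%:R) *
  complex.Re (fcoef uC k * chi R k x).

Lemma poisson_gt0 s x : 0 <= s -> 0 < poisson s uC x.
Proof.
rewrite le_eqVlt => /orP[/eqP<-|s0]; first by rewrite poisson0 ltcR.
rewrite poisson_pkernel (bigD1 x)//= ltr_pwDl//; first by rewrite mulr_gt0 ?ltcR ?pkernel_gt0.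
by apply: sumr_ge0 => y _; rewrite mulr_ge0 ?ler0c ?ltW ?pkernel_gt0.
Qed.

Lemma poisson_derivative x s : hasder (U x) s (dU x s).
Proof.
rewrite (_ : U x = fun s => \sum_(k < n) expR (- s * (psi k)%:R) * complex.Re (fcoef uC k * chi R k x)).
  apply: der_eq; first by der.
  by apply: eq_bigr => k _ /=; ring.
apply/funext => s'; rewrite /U /poisson Re_sum; apply: eq_bigr => k _.
by rewrite -mulrA ReM_real.
Qed.

(** The derivative of P_s u multiplies the coefficient of frequency k of P_s u by - psi k;
    the identity is then that of Parseval. *)
Lemma avg_derivative v s : 0 <= s -> avg (fun x => v x * dU x s) = - dirichlet (fun x => U x s) v.
Proof.
move=> s0.
pose W x := \sum_(k < n) ((- (psi k)%:R * expR (- s * (psi k)%:R))%:C%C * fcoef uC k) * chi R k x.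
have WE x : complex.Re (W x) = dU x s.
  by rewrite /W Re_sum; apply: eq_bigr => k _; rewrite -mulrA ReM_real.
have := parseval W (fun x => (v x)%:C%C) => /(congr1 (@complex.Re R)).
rewrite -natC -fmorphV ReM_real !Re_sum => P.
transitivity (n%:R^-1 * \sum_x complex.Re (W x * ((v x)%:C%C)^*%C)).
  by congr (_ * _); apply: eq_bigr => x _; rewrite -WE conjc_real [W x * _]mulrC ReM_real.
rewrite P /dirichlet -sumrN; apply: eq_bigr => k _.
have -> : (fun x => (U x s)%:C%C) = poisson s uC.
  by apply/funext => x; rewrite /U; have [<-] := pos_real (poisson_gt0 x s0).
rewrite fcoef_poisson fcoef_trig -!mulrA !ReM_real; ring.
Qed.

End positive.

Section sufficiency.
Context (k : nat) (k0 : (1 <= k)%N) (nE : n = (3 * 2 ^ k)%N \/ n = (2 ^ k)%N).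
Context (p q t : R) (p1 : 1 < p) (pq : p <= q) (t0 : 0 < t)
  (tpq : 2^-1 * ln ((q - 1) / (p - 1)) <= t).

(** The exponent follows q(s) = 1 + (p - 1) e^(2ls), with l <= 1 chosen so that q(t) = q. *)
Lemma hypercontractive_pos u : (forall x, 0 < u x) ->
  pnorm q (poisson t (fun x => (u x)%:C%C)) <= pnorm p (fun x => (u x)%:C%C).
Proof.
move=> u0; have en := even_order k0 nE; have n0 := order_gt0 nE.
set uC := fun x => (u x)%:C%C.
pose U x s := complex.Re (poisson s uC x).
pose dU x s := \sum_(k < n) - (psi k)%:R * expR (- s * (psi k)%:R) *
  complex.Re (fcoef uC k * chi R k x).
have U0 x s : 0 <= s -> 0 < U x s.
  by move=> s0; have [_] := pos_real (poisson_gt0 en u0 x s0).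
pose l := ln ((q - 1) / (p - 1)) / (2 * t).
have p10 : 0 < p - 1 by rewrite subr_gt0.
have r1 : 1 <= (q - 1) / (p - 1) by rewrite ler_pdivlMr// mul1r lerD2r.
have l01 : 0 <= l <= 1.
  have t2 : 0 < 2 * t by rewrite mulr_gt0.
  rewrite /l divr_ge0 ?ln_ge0//= ?(ltW t2)// ler_pdivrMr//; have := tpq; lra.
have := @lognorm_nonincreasing R n U dU p l t n0 p1 l01 (ltW t0) U0.
have dUE x s : hasder (U x) s (dU x s) := poisson_derivative u x s.
have I s (v : 'I_n -> R) : 0 <= s -> avg (fun x => v x * dU x s) = - dirichlet (fun x => U x s) v.
  exact: avg_derivative.
move=> /(_ dUE).
have LSI s q' : 0 <= s -> 1 < q' ->
     avg (fun x => expR (q' * ln (U x s)) * (q' * ln (U x s)))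
     - avg (fun x => expR (q' * ln (U x s))) * ln (avg (fun x => expR (q' * ln (U x s))))
     <= - (q' ^+ 2 / (2 * (q' - 1)) * avg (fun x => expR ((q' - 1) * ln (U x s)) * dU x s)).
  move=> s0 q1; rewrite I// mulrN opprK.
  by apply: (log_sobolev_q k0 nE) => // x; exact: U0.
move=> /(_ LSI).
have dis s q' : 0 <= s -> 1 < q' -> avg (fun x => expR ((q' - 1) * ln (U x s)) * dU x s) <= 0.
  move=> s0 q1; rewrite I// oppr_le0.
  by apply: (dirichlet_power_ge0 k0 nE) => // x; exact: U0.
move=> /(_ dis (fun s => 1 + (p - 1) * expR (2 * l * s)) (fun=> erefl)) /=.
have -> : 1 + (p - 1) * expR (2 * l * t) = q.
  rewrite (_ : 2 * l * t = ln ((q - 1) / (p - 1))); last by rewrite /l; field; rewrite gt_eqF.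
  by rewrite lnK ?posrE ?(lt_le_trans ltr01)//; field; rewrite gt_eqF.
have -> : 1 + (p - 1) * expR (2 * l * 0) = p by rewrite mulr0 expR0; ring.
have -> : poisson t uC = fun x => (U x t)%:C%C.
  by apply/funext => x; rewrite /U; have [<-] := pos_real (poisson_gt0 en u0 x (ltW t0)).
rewrite !pnorm_pos//; last by move=> x; apply: U0; exact: ltW.
rewrite ler_expR; have -> // : (fun x => expR (p * ln (u x))) = fun x => expR (p * ln (U x 0)).
by apply/funext => x; rewrite /U poisson0.
Qed.

(** As the kernel is positive, |P_t f| <= P_t (|f| + e) pointwise for e > 0. *)
Lemma hypercontractive (f : 'I_n -> R[i]) : pnorm q (poisson t f) <= pnorm p f.
Proof.
have en := even_order k0 nE; have p0 : 0 < p by have := p1; lra.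
have q0 : 0 < q by have := pq; lra.
have dom e : 0 < e -> pnorm q (poisson t f) <= pnorm p (fun x => (Normc.normc (f x) + e)%:C%C).
  move=> e0; have ge0 x : 0 < Normc.normc (f x) + e by rewrite ltr_wpDl ?normc_ge0.
  apply: le_trans (hypercontractive_pos ge0).
  apply: pnorm_le; first exact: ltW.
  move=> x; rewrite -lecR !norm_normc !poisson_pkernel.
  apply: (le_trans (ler_norm_sum _ _ _)).
  apply: (@le_trans _ _ (\sum_y pkernel t x y * (Normc.normc (f y) + e)%:C%C)); last first.
    by rewrite real_ler_norm// ger0_real// sumr_ge0// => y _; rewrite mulr_ge0 ?ler0c ?ltW ?pkernel_gt0.
  apply: ler_sum => y _; rewrite normrM gtr0_norm ?pkernel_gt0// ler_wpM2l ?ltW ?pkernel_gt0//.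
  by rewrite -[`|f y|]norm_normc ltcR ltrDl.
set C := pnorm q _ in dom *.
have C0 : 0 <= C by exact: powR_ge0.
have pow (g : 'I_n -> R) : (forall x, 0 <= g x) -> C <= pnorm p (fun x => (g x)%:C%C) ->
   C `^ p <= avg (fun x => g x `^ p).
  move=> g0; rewrite pnorm_avg => H.
  have A0 : 0 <= avg (fun x => g x `^ p) by apply: avg_ge0 => x; exact: powR_ge0.
  have E : avg (fun x => Normc.normc (g x)%:C%C `^ p) = avg (fun x => g x `^ p).
    by congr (_ * _); apply: eq_bigr => x _; rewrite /= expr0n addr0 sqrtr_sqr ger0_norm.
  rewrite E in H; apply: (@le_trans _ _ ((avg (fun x => g x `^ p) `^ p^-1) `^ p)).
    by rewrite ge0_ler_powR ?nnegrE ?powR_ge0// ltW.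
  by rewrite -powRrM mulVf ?gt_eqF// powRr1.
have : C `^ p <= avg (fun x => Normc.normc (f x) `^ p).
  apply: avg_shift_le => // [x|e e0]; first exact: normc_ge0.
  by apply: pow; [move=> x; rewrite addr_ge0 ?normc_ge0 ?ltW|exact: dom].
move=> H; rewrite pnorm_avg.
apply: (@le_trans _ _ ((C `^ p) `^ p^-1)); first by rewrite -powRrM mulfV ?gt_eqF// powRr1.
have A0 : 0 <= avg (fun x => Normc.normc (f x) `^ p) by apply: avg_ge0 => x; exact: powR_ge0.
by rewrite ge0_ler_powR ?nnegrE ?powR_ge0 ?invr_ge0 ?(ltW p0).
Qed.
End sufficiency.
End Hyper.

(** * Necessity *)

Section Necessity.
Context {R : realType} (n : nat) (n1 : (1 < n)%N).
Local Arguments conjc : simpl never.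
Implicit Types (p q t e : R).

Let wave (x : 'I_n) : R := cos (2 * pi * x%:R / n%:R).
Let n0 : (0 < n)%N. Proof. exact: ltnW. Qed.
Let nR : n%:R != 0 :> R. Proof. by rewrite pnatr_eq0 -lt0n. Qed.
Let o0 : 'I_n := Ordinal n0.
Let o1 : 'I_n := Ordinal n1.
Lemma pred_lt : (n.-1 < n)%N. Proof. by rewrite prednK. Qed.
Let om : 'I_n := Ordinal pred_lt.

Lemma poissonD t (f g : 'I_n -> R[i]) (c : R[i]) x :
  poisson t (fun y => f y + c * g y) x = poisson t f x + c * poisson t g x.
Proof.
rewrite !poisson_pkernel mulr_sumr -big_split; apply: eq_bigr => y _ /=; ring.
Qed.

Lemma poisson_chi t (k : 'I_n) x :
  poisson t (chi R k) x = (expR (- t * (psi k)%:R))%:C%C * chi R k x.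
Proof.
have -> : chi R k = fun y => \sum_(j < n) (j == k)%:R * chi R j y.
  apply/funext => y; rewrite (bigD1 k)//= eqxx mul1r big1 ?addr0// => j /negPf ->.
  by rewrite mul0r.
rewrite poisson_trig mulr_sumr; apply: eq_bigr => j _; rewrite -mulrA.
by have [->|] := eqVneq j k; rewrite ?mul0r ?mulr0.
Qed.

Lemma chi0 x : chi R o0 x = 1.
Proof. by rewrite /chi mulr0 !mul0r expi0. Qed.

(** The characters of frequencies 1 and n - 1 are conjugate; they are equal if n = 2. *)
Lemma cos_chi x : (wave x)%:C%C = 2^-1 * chi R o1 x + 2^-1 * chi R om x.
Proof.
have -> : chi R om x = (chi R o1 x)^*%C.
  rewrite /chi -expiN /= -[LHS]mulr1 -[in LHS](conjc1 R) -(expi_2pi R x) -expiN -expiD.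
  congr expi; rewrite -subn1 natrB//; field; exact: nR.
rewrite /chi /= mulr1 /expi /wave; simpc.
by congr (_ +i* _)%C; field.
Qed.

Lemma psi_om : psi om = 1%N.
Proof. by rewrite /psi /=; lia. Qed.

Lemma psi_o1 : psi o1 = 1%N.
Proof. by rewrite /psi /=; lia. Qed.

Lemma wave_chi (a : R) x : (1 + a * wave x)%:C%C =
  (chi R o0 x + (a / 2)%:C%C * chi R o1 x) + (a / 2)%:C%C * chi R om x.
Proof.
by rewrite chi0 rmorphD rmorph1 rmorphM /= cos_chi rmorphM /= fmorphV /= natC; ring.
Qed.

Lemma poisson_cos t e x :
  poisson t (fun y => (1 + e * wave y)%:C%C) x = (1 + (e * expR (- t)) * wave x)%:C%C.
Proof.
rewrite wave_chi; under eq_fun do rewrite wave_chi.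
rewrite poissonD poissonD !poisson_chi psi_om psi_o1 !mulr1.
rewrite {1}/psi /= min0n mulr0 expR0 mul1r.
by rewrite !rmorphM /=; ring.
Qed.

Lemma wave_le1 x : -1 <= wave x <= 1.
Proof. by rewrite cos_geN1 cos_le1. Qed.

Lemma avg_wave : avg wave = 0.
Proof.
have := chi_ortho R o1 o0; rewrite -val_eqE /= mul0r => H.
rewrite /avg (_ : \sum_x wave x = 0) ?mulr0// -[RHS]/(complex.Re (0 : R[i])) -H Re_sum.
apply: eq_bigr => x _; rewrite chi0 conjc1 mulr1 /chi /expi /= /wave; congr cos.
by rewrite mulr1.
Qed.

Lemma avg_wave2 : 0 < avg (fun x => wave x ^+ 2).
Proof.
rewrite /avg mulr_gt0 ?invr_gt0 ?ltr0n// (bigD1 o0)//= ltr_pwDl//.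
  by rewrite /wave /= mulr0 mul0r cos0 expr1n.
by apply: sumr_ge0 => x _; exact: sqr_ge0.
Qed.

(** The derivatives of ln (phi p) / p at 0 are [dphi p 0] = 0 and
    (p - 1) times the mean of the squared cosine. *)
Let phi p e := avg (fun x => expR (p * ln (1 + e * wave x))).
Let dphi p e := avg (fun x => wave x * expR ((p - 1) * ln (1 + e * wave x))).

Lemma wave_pos e x : `|e| < 1 -> 0 < 1 + e * wave x.
Proof.
rewrite ltr_norml => /andP[e1 e2]; have /andP[a b] := wave_le1 x.
have [e0|/ltW e0] := leP 0 e.
  have := mulr_ge0 e0 (_ : 0 <= 1 + wave x); lra.
have := mulr_ge0_le0 (_ : 0 <= 1 - wave x) e0; lra.
Qed.

Lemma phi_gt0 p e : 0 < phi p e.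
Proof.
rewrite /phi /avg mulr_gt0 ?invr_gt0 ?ltr0n// (bigD1 o0)//= ltr_pwDl ?expR_gt0//.
by apply: sumr_ge0 => x _; exact: expR_ge0.
Qed.

Lemma phi_der p e : `|e| < 1 -> hasder (phi p) e (p * dphi p e).
Proof.
move=> e1; rewrite /phi /avg; apply: der_eq.
  apply: der_mul; first exact: der_cst.
  by apply: der_sum => x; der; exact: wave_pos.
rewrite [X in _ + X]mulr0 addr0 /dphi /avg mulrCA; congr (_ * _); rewrite mulr_sumr; apply: eq_bigr => x _ /=.
rewrite [(p - 1) * _]mulrBl mul1r expRB lnK ?posrE ?wave_pos//.
by field; rewrite gt_eqF// wave_pos.
Qed.

Lemma dphi_der p : hasder (dphi p) 0 ((p - 1) * avg (fun x => wave x ^+ 2)).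
Proof.
rewrite /dphi /avg; apply: der_eq.
  apply: der_mul; first exact: der_cst.
  by apply: der_sum => x; der; apply: wave_pos; rewrite normr0.
rewrite [X in _ + X]mulr0 addr0 mulrCA; congr (_ * _); rewrite mulr_sumr; apply: eq_bigr => x _ /=.
by rewrite mul0r addr0 ln1 invr1 mulr0 expR0; ring.
Qed.

Lemma phi0 p : phi p 0 = 1.
Proof.
rewrite /phi /avg (eq_bigr (fun=> 1)) ?sumr_const ?card_ord ?mulVf// => x _.
by rewrite mul0r addr0 ln1 mulr0 expR0.
Qed.

Lemma dphi0 p : dphi p 0 = 0.
Proof.
rewrite -[RHS]avg_wave /dphi; congr (_ * _); apply: eq_bigr => x _.
by rewrite mul0r addr0 ln1 mulr0 expR0 mulr1.
Qed.

(** The difference G of the logarithms of the norms of 1 + e cos and of its image is nonnegative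
    and vanishes at e = 0 with its derivative G1. By the mean value theorem G1 is nonnegative at points arbitrarily
    close to 0 on the right, so its derivative at 0 is nonnegative. *)
Lemma hypercontractive_necessary p q t : 1 < p -> 1 < q -> 0 <= t ->
  (forall f : 'I_n -> R[i], pnorm q (poisson t f) <= pnorm p f) ->
  (q - 1) * expR (- t) ^+ 2 <= p - 1.
Proof.
move=> p1 q1 t0 H; set r := expR (- t).
have r01 : 0 < r <= 1 by rewrite expR_gt0 expR_le1 oppr_le0.
have [r0 r1] := andP r01.
have re e : `|e| < 1 -> `|e * r| < 1.
  by move=> e1; rewrite normrM (ger0_norm (ltW r0)); apply: le_lt_trans e1; rewrite ler_piMr.
pose G e := ln (phi p e) / p - ln (phi q (e * r)) / q.
pose G1 e := dphi p e / phi p e - r * (dphi q (e * r) / phi q (e * r)).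
have GE e : `|e| < 1 -> 0 <= G e.
  move=> e1; have := H (fun y => (1 + e * wave y)%:C%C).
  rewrite (_ : poisson t _ = fun x => (1 + (e * r) * wave x)%:C%C); last first.
    by apply/funext => x; rewrite poisson_cos.
  rewrite !pnorm_pos//; [|by move=> x; exact: wave_pos|by move=> x; apply: wave_pos; exact: re].
  by rewrite ler_expR /G subr_ge0.
have Gder e : `|e| < 1 -> hasder G e (G1 e).
  move=> e1; have d1 := phi_der p e1; have e2 := re e e1.
  have d2 : hasder (fun e => phi q (e * r)) e (q * dphi q (e * r) * r).
    by apply: (@der_comp _ (phi q) (fun e => e * r) e _ _ (phi_der q e2)); apply: der_eq; [der|rewrite /=; ring].
  have f1 := phi_gt0 p e; have f2 := phi_gt0 q (e * r).
  rewrite /G; apply: der_eq; first by der.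
  by rewrite /G1 /=; field; rewrite !gt_eqF//; lra.
have G1der : hasder G1 0 ((p - 1) * avg (fun x => wave x ^+ 2) - r * ((q - 1) * avg (fun x => wave x ^+ 2) * r)).
  have z1 : `|0 : R| < 1 by rewrite normr0.
  have d1 := phi_der p z1; have a1 := dphi_der p.
  have d2 : hasder (fun e => phi q (e * r)) 0 (q * dphi q (0 * r) * r).
    by apply: (@der_comp _ (phi q) (fun e => e * r) 0 _ _ (phi_der q (re _ z1))); apply: der_eq; [der|rewrite /=; ring].
  have a2 : hasder (fun e => dphi q (e * r)) 0 ((q - 1) * avg (fun x => wave x ^+ 2) * r).
    apply: (@der_comp _ (dphi q) (fun e => e * r)); first by rewrite mul0r; exact: dphi_der.
    by apply: der_eq; [der|rewrite /=; ring].
  have f1 : phi p 0 != 0 by rewrite phi0 oner_neq0.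
  have f2 : phi q (0 * r) != 0 by rewrite mul0r phi0 oner_neq0.
  rewrite /G1; apply: der_eq; first by der.
  by rewrite /= mul0r !dphi0 !phi0; field.
have G10 : G1 0 = 0 by rewrite /G1 mul0r !dphi0 !mul0r mulr0 subrr.
have G0 : G 0 = 0 by rewrite /G mul0r !phi0 ln1 !mul0r subrr.
have : 0 <= (p - 1) * avg (fun x => wave x ^+ 2) - r * ((q - 1) * avg (fun x => wave x ^+ 2) * r).
  apply: (der_frequently_ge0 G1der) => e e0.
  pose d := Num.min e (1 / 2).
  have d0 : 0 < d by rewrite lt_min e0; lra.
  have d1 : d < 1 by rewrite gt_min; apply/orP; right; lra.
  have small c : 0 <= c <= d -> `|c| < 1.
    by move=> /andP[c0 cd]; rewrite ger0_norm//; lra.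
  have [c|c|c] := @MVT R G G1 0 d d0.
  - by rewrite in_itv /= => /andP[c0 cd]; apply: Gder; apply: small; rewrite !ltW.
  - apply/continuous_in_subspaceT => x; rewrite inE /= in_itv /= => xI.
    exact: der_continuous (Gder x (small _ xI)).
  rewrite in_itv /= => /andP[c0 cd]; rewrite G0 !subr0 => E.
  exists c; first by rewrite c0 (lt_le_trans cd)// ge_min lexx.
  rewrite G10; have : 0 <= G1 c * d by rewrite -E GE// small// ltW//= lexx.
  by rewrite pmulr_lge0.
have := avg_wave2; set B := avg _ => B0.
have -> : (p - 1) * B - r * ((q - 1) * B * r) = B * ((p - 1) - (q - 1) * r ^+ 2) by ring.
by rewrite pmulr_rge0// subr_ge0.
Qed.
End Necessity.

Theorem theorem1p1 (R : realType) (n k : nat)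
    (hk : (1 <= k)%N) (hn : n = (3 * 2 ^ k)%N \/ n = (2 ^ k)%N)
    (p q t : R) (hp : 1 < p) (hpq : p <= q) (ht : 0 <= t) :
  (forall f : 'I_n -> R[i], pnorm q (poisson t f) <= pnorm p f) <->
  2^-1 * ln ((q - 1) / (p - 1)) <= t.
Proof.
have p10 : 0 < p - 1 by rewrite subr_gt0.
have q1 : 1 < q by exact: lt_le_trans hp hpq.
have q10 : 0 < q - 1 by rewrite subr_gt0.
have r0 : 0 < (q - 1) / (p - 1) by rewrite divr_gt0.
split=> [H|tpq f].
  have n1 : (1 < n)%N.
    by have := even_order hk hn; have := order_gt0 hn; case: (n) => [|[|]].
  have := hypercontractive_necessary n1 hp q1 ht H.
  rewrite -expRM_natr mulNr expRN ler_pdivrMr ?expR_gt0// => le.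
  have : (q - 1) / (p - 1) <= expR (t * 2%:R) by rewrite ler_pdivrMr// mulrC.
  rewrite -(ler_ln (_ : _ \in Num.pos)) ?posrE ?expR_gt0// expRK; lra.
move: ht; rewrite le_eqVlt => /orP[/eqP t0|t0]; last exact: hypercontractive hk hn _ _ _ hp hpq t0 tpq f.
have qp : q = p.
  apply/le_anti; rewrite hpq andbT.
  have : ln ((q - 1) / (p - 1)) <= ln 1 by rewrite ln1; lra.
  by rewrite ler_ln ?posrE// ler_pdivrMr// mul1r lerD2r.
rewrite -t0 qp (_ : poisson 0 f = f)//; apply/funext => x; exact: poisson0.
Qed.
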